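(* Let $f:\mathbb{T}\to\mathbb{R}\cup\{\pm\infty\}$ be a measurable function. Then there exist complex coefficients $(c(k))_{k\ge 1}$ such that $$f(t)=\sum_{k>0}c(k)e^{ikt},$$ where the series converges in measure, in the sense that the real parts of the partial sums $\sum_{k=1}^N c(k)e^{ikt}$ converge in measure to $f$ and the imaginary parts converge in measure to $0$ as $N\to\infty$.
   Context: $\mathbb{T}=\mathbb{R}/2\pi\mathbb{Z}$ with normalized Lebesgue measure $\mathbf{m}$. Convergence in measure of real measurable functions $u_N$ to a measurable $f:\mathbb{T}\to\mathbb{R}\cup\{\pm\infty\}$ means: for every $\eta>0$, $\mathbf{m}\{t: f(t)\in\mathbb{R},\ |u_N(t)-f(t)|>\eta\}\to0$, and for every $M>0$, $\mathbf{m}\{t: f(t)=+\infty,\ u_N(t)<M\}\to 0$ and $\mathbf{m}\{t: f(t)=-\infty,\ u_N(t)>-M\}\to0$, as $N\to\infty$. *)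

(* Defs.v *)
From HB Require Import structures.
From mathcomp Require Import all_boot all_order all_algebra.
From mathcomp Require Import all_classical all_reals all_analysis.
From mathcomp Require Import measurable_realfun complex.

Set Implicit Arguments.
Unset Strict Implicit.
Unset Printing Implicit Defensive.
Import Order.TTheory GRing.Theory Num.Theory.
Import numFieldNormedType.Exports.

Local Open Scope classical_set_scope.
Local Open Scope ring_scope.

(* [R] equipped with the sigma-algebra of Lebesgue measurable sets, i.e. the
   domain of [completed_lebesgue_measure].  [R] itself only carries the Borel
   sigma-algebra. *)
Notation lebesgueType R :=
  (caratheodory_type ((@wlength R idfun)^*)%mu).

(* The circle T = R / 2 pi Z is handled through the identification of functions
   on T with 2 pi-periodic functions on R, and of subsets of T with 2 pi-periodic
   subsets of R. *)
Definition on_circle (R : realType) (Y : Type) (f : R -> Y) : Prop :=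
  forall t, f (t + 2 * pi) = f t.

Lemma measurable_fundamental (R : realType) :
  measurable (`[0, 2 * pi[%classic : set (lebesgueType R)).
Proof. by apply: sub_caratheodory; exact: measurable_itv. Qed.

Lemma inv2pi_ge0 (R : realType) : 0 <= (2 * pi)^-1 :> R.
Proof. by rewrite invr_ge0 mulr_ge0// pi_ge0. Qed.

(* Normalized Lebesgue measure on T: a measurable subset of T, seen as a
   2 pi-periodic subset of R, has as measure the Lebesgue measure of its trace
   on the fundamental domain [0, 2 pi[, divided by 2 pi. *)
Definition circle_measure (R : realType) : set (lebesgueType R) -> \bar R :=
  mscale (NngNum (inv2pi_ge0 R))
    (mrestr (@completed_lebesgue_measure R) (@measurable_fundamental R)).
HB.instance Definition _ (R : realType) := Measure.on (@circle_measure R).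

Lemma circle_measureE (R : realType) (A : set (lebesgueType R)) :
  circle_measure A = (((2 * pi)^-1)%:E *
    completed_lebesgue_measure (A `&` `[0%R, (2 * pi)%R[%classic))%E.
Proof. by []. Qed.

Lemma circle_measure_setT (R : realType) : @circle_measure R setT = 1%E.
Proof.
rewrite circle_measureE setTI.
have -> : completed_lebesgue_measure `[0%R, (2 * pi)%R[%classic
    = @lebesgue_measure R `[0%R, (2 * pi)%R[%classic by [].
rewrite lebesgue_measure_itv/= lte_fin mulr_gt0 ?pi_gt0// sube0 -EFinM.
by rewrite mulVf// mulf_neq0// gt_eqF// pi_gt0.
Qed.

HB.instance Definition _ (R : realType) :=
  Measure_isProbability.Build _ _ _ (@circle_measure R)
    (@circle_measure_setT R).

Definition cvg_in_measure (d : measure_display) (T : measurableType d)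
    (R : realType) (mu : {measure set T -> \bar R})
    (u : nat -> T -> R) (f : T -> \bar R) : Prop :=
  [/\ forall eta : R, 0 < eta ->
        mu [set t | f t \is a fin_num /\ eta < `|u N t - fine (f t)|]
          @[N --> \oo] --> 0%E,
      forall M : R, 0 < M ->
        mu [set t | f t = +oo%E /\ u N t < M] @[N --> \oo] --> 0%E
    & forall M : R, 0 < M ->
        mu [set t | f t = -oo%E /\ - M < u N t] @[N --> \oo] --> 0%E].

(* e^{ix} for real x *)
Definition expi (R : realType) (x : R) : R[i] := Complex (cos x) (sin x).

Definition trig_psum (R : realType) (c : nat -> R[i]) (N : nat) (t : R) : R[i] :=
  \sum_(1 <= k < N.+1) c k * expi (k%:R * t).

(* Main.v *)
Require Import Defs.
From mathcomp Require Import all_boot all_order all_algebra.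
From mathcomp Require Import all_classical all_reals all_analysis.
From mathcomp Require Import measurable_realfun complex.
From mathcomp Require Import ring lra zify.

(* Call [W] the difference between a target trigonometric polynomial and the
   sum constructed so far. It is multiplied by a random walk [F], built as
   [F := F * (1 - a(|F|^2) * e^{int})] with [a] small and [n] so large that the
   subtracted term only has new, larger frequencies. As [n] grows, [e^{int}]
   becomes independent of [F]: the mean of [log |F|] is nearly preserved, while
   that of [|F|^2] increases by the mean of [|F|^2 * a^2]. With
   [a(x)] proportional to [(x - m) * (M - x)], [|F|^2] stays in [[m, M]],
   so the increments must become small and [|F|^2] concentrates near [m] and [M];
   the conservation of [log |F|] makes the value [M] unlikely when [M] is huge,
   hence [W * F] is smaller than [W] outside a set of small measure, and at
   each moment at most a constant times [W] outside a small set. Partial sums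
   inside one step differ from [W * F] by a term which is small in [L^2] by Bessel's
   inequality. Iterating, with targets approximating [f] truncated at the levels
   [+- log (n + 2)], gives the series: the increments [1 / n] of the levels
   absorb the constants even where [f] is infinite. *)

Set Implicit Arguments.
Unset Strict Implicit.
Unset Printing Implicit Defensive.
Import Order.TTheory GRing.Theory Num.Theory.
Import numFieldNormedType.Exports.

Local Open Scope classical_set_scope.
Local Open Scope ring_scope.
Local Open Scope complex_scope.

Local Notation Re := complex.Re.
Local Notation Im := complex.Im.

(** * Bounded measurable functions and exceptional sets *)

Section BoundedMeasurable.
Context d (T : measurableType d) (R : realType).
Implicit Types f g : T -> R.

(** The constant by which a remainder may grow inside a step does not stay bounded. Control of the
    mean of [ln (|F| ^ 2)] gives [|F| ^ 2 < B] only outside a set of measure of order [1 / ln B], so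
    [B] has to tend to infinity along the steps. Step [n] takes [B = n + 2]. The remainder it starts
    from has squared modulus of the order of the squared distance of consecutive targets, and [B]
    times this must tend to 0. Levels [ln (n + 2)] move by at most [1 / (n + 2)], which leaves a
    product of order [1 / (n + 2)], and they still tend to infinity. Partial sums are examined one
    at a time, each with its own exceptional set, so the number of substeps of a walk costs nothing
    in measure. *)

Definition bounded_mfun f :=
  measurable_fun setT f /\ exists B, forall t, `|f t| <= B.

Lemma bounded_mfun_cst (r : R) : bounded_mfun (cst r).
Proof. by split => //; exists `|r|. Qed.

Lemma bounded_mfunN f : bounded_mfun f -> bounded_mfun (fun t => - f t).
Proof.
move=> [mf [B fB]]; split; first exact: measurableT_comp.
by exists B => t; rewrite normrN.
Qed.

Lemma bounded_mfunD f g : bounded_mfun f -> bounded_mfun g ->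
  bounded_mfun (fun t => f t + g t).
Proof.
move=> [mf [B fB]] [mg [C gC]]; split; first exact: measurable_funD.
by exists (B + C) => t; rewrite (le_trans (ler_normD _ _))// lerD.
Qed.

Lemma bounded_mfunB f g : bounded_mfun f -> bounded_mfun g ->
  bounded_mfun (fun t => f t - g t).
Proof. by move=> bf bg; apply/bounded_mfunD/bounded_mfunN. Qed.

Lemma bounded_mfunM f g : bounded_mfun f -> bounded_mfun g ->
  bounded_mfun (fun t => f t * g t).
Proof.
move=> [mf [B fB]] [mg [C gC]]; split; first exact: measurable_funM.
by exists (B * C) => t; rewrite normrM ler_pM.
Qed.

Lemma bounded_mfunX f n : bounded_mfun f -> bounded_mfun (fun t => f t ^+ n).
Proof.
move=> bf; elim: n => [|n IHn]; first exact: bounded_mfun_cst.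
under [fun t => _ ^+ _]eq_fun do rewrite exprS.
exact: bounded_mfunM.
Qed.

Lemma bounded_mfunZ (r : R) f : bounded_mfun f -> bounded_mfun (fun t => r * f t).
Proof. by move=> bf; apply/bounded_mfunM/bf/bounded_mfun_cst. Qed.

Lemma bounded_mfun_indic (A : set T) : measurable A -> bounded_mfun (\1_A : T -> R).
Proof.
move=> mA; split; first exact: measurable_indic.
by exists 1 => t; rewrite indicE; case: (_ \in _); rewrite ?normr1 ?normr0.
Qed.

Lemma bounded_mfun_ln f (a b : R) : measurable_fun setT f -> 0 < a ->
  (forall t, a <= f t <= b) -> bounded_mfun (fun t => ln (f t)).
Proof.
move=> mf a0 fab; split; first exact: measurableT_comp.
exists (Num.max `|ln a| `|ln b|) => t; have /andP[aft ftb] := fab t.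
have ft0 : 0 < f t by exact: lt_le_trans aft.
have l1 : ln a <= ln (f t) by rewrite ler_ln// posrE.
have l2 : ln (f t) <= ln b by rewrite ler_ln// posrE (lt_le_trans ft0).
rewrite le_max; have [p|p] := leP 0 (ln (f t)).
  by rewrite (ger0_norm p) (ger0_norm (le_trans p l2)) l2 orbT.
by rewrite (ltr0_norm p) (ltr0_norm (le_lt_trans l1 p)) lerN2 l1.
Qed.

End BoundedMeasurable.

Section Mean.
Context d (T : measurableType d) (R : realType) (P : probability T R).
Implicit Types f g : T -> R.

Definition mean f : R := \int[P]_t f t.

Lemma integrable_bounded_mfun f : bounded_mfun f ->
  P.-integrable setT (EFin \o f).
Proof.
move=> [mf [B fB]]; apply: measurable_bounded_integrable => //.
  exact: le_lt_trans (probability_le1 P measurableT) (ltry 1).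
by exists B; split; [exact: num_real|move=> M /ltW BM t _; exact: le_trans BM].
Qed.

Lemma mean_cst r : mean (cst r) = r.
rewrite /mean Rintegral_cst// -[RHS]mulr1; congr (_ * _).
exact: (congr1 fine (probability_setT P)).
Qed.

Lemma meanD f g : bounded_mfun f -> bounded_mfun g ->
  mean (fun t => f t + g t) = mean f + mean g.
Proof. by move=> bf bg; rewrite /mean RintegralD//; exact: integrable_bounded_mfun. Qed.

Lemma meanB f g : bounded_mfun f -> bounded_mfun g ->
  mean (fun t => f t - g t) = mean f - mean g.
Proof. by move=> bf bg; rewrite /mean RintegralB//; exact: integrable_bounded_mfun. Qed.

Lemma meanZ r f : bounded_mfun f -> mean (fun t => r * f t) = r * mean f.
Proof. by move=> bf; rewrite /mean RintegralZl//; exact: integrable_bounded_mfun. Qed.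

Lemma le_mean f g : bounded_mfun f -> bounded_mfun g ->
  (forall t, f t <= g t) -> mean f <= mean g.
Proof. by move=> bf bg fg; apply: le_Rintegral => //; exact: integrable_bounded_mfun. Qed.

Lemma mean_ge0 f : (forall t, 0 <= f t) -> 0 <= mean f.
Proof. by move=> f0; exact: Rintegral_ge0. Qed.

Lemma mean_indic (A : set T) : measurable A -> mean \1_A = fine (P A).
Proof.
by move=> mA; rewrite /mean /Rintegral integral_indic// setIT.
Qed.

(* [whp e Q]: the property [Q], which need not be measurable, holds outside a
   measurable set of probability at most [e]. *)
Definition whp (e : R) (Q : T -> Prop) :=
  exists A, [/\ measurable A, (P A <= e%:E)%E & forall t, ~ A t -> Q t].

Lemma whp_mono e e' (Q Q' : T -> Prop) : e <= e' -> (forall t, Q t -> Q' t) ->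
  whp e Q -> whp e' Q'.
Proof.
move=> ee' QQ' [A [mA PA AQ]]; exists A; split => //.
  by rewrite (le_trans PA)// lee_fin.
by move=> t /AQ/QQ'.
Qed.

Lemma whpS e (Q Q' : T -> Prop) : (forall t, Q t -> Q' t) -> whp e Q -> whp e Q'.
Proof. exact: whp_mono. Qed.

Lemma whpI e e' (Q Q' : T -> Prop) : whp e Q -> whp e' Q' ->
  whp (e + e') (fun t => Q t /\ Q' t).
Proof.
move=> [A [mA PA AQ]] [B [mB PB BQ]]; exists (A `|` B); split.
- exact: measurableU.
- by rewrite (le_trans (measureU2 _ mA mB))// EFinD leeD.
- by move=> t /not_orP[/AQ Qt /BQ].
Qed.

Lemma whp_all e (Q : T -> Prop) : 0 <= e -> (forall t, Q t) -> whp e Q.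
Proof. by move=> e0 allQ; exists set0; rewrite measure0 lee_fin. Qed.

Lemma measure_le_whp e (A : set T) : measurable A -> whp e (fun t => ~ A t) ->
  (P A <= e%:E)%E.
Proof.
move=> mA [B [mB PB BA]]; apply: le_trans PB.
by apply: le_measure; rewrite ?inE// => t At; apply: contrapT => /BA; exact.
Qed.

Lemma whp_markov f c e : bounded_mfun f -> (forall t, 0 <= f t) -> 0 < c ->
  mean f <= c * e -> whp e (fun t => f t < c).
Proof.
move=> bf f0 c0 fce.
have mA : measurable [set t | c <= f t].
  by rewrite -[X in measurable X]setTI; apply: measurable_fun_le => //; case: bf.
exists [set t | c <= f t]; split => //; last first.
  by move=> t /= /negP; rewrite -ltNge.
rewrite -[P _]fineK ?fin_num_measure// lee_fin -(ler_pM2l c0).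
rewrite (le_trans _ fce)// -mean_indic// -meanZ; last exact: bounded_mfun_indic.
apply: le_mean => //; first exact/bounded_mfunZ/bounded_mfun_indic.
move=> t; rewrite indicE; case: (boolP (t \in _)) => [|_]; last by rewrite mulr0.
by rewrite inE/= mulr1.
Qed.

End Mean.

(** * Trigonometric polynomials *)

Section SquaredModulus.
Context (R : realType).
Implicit Types z w : R[i].

(** The squared modulus is kept in [R] and polynomial in the two parts: identities follow by [ring],
    and it maps trigonometric polynomials to trigonometric polynomials. *)
Definition nsq z : R := Re z ^+ 2 + Im z ^+ 2.

Lemma ReD z w : Re (z + w) = Re z + Re w. Proof. by case: z; case: w. Qed.
Lemma ImD z w : Im (z + w) = Im z + Im w. Proof. by case: z; case: w. Qed.
Lemma ReN z : Re (- z) = - Re z. Proof. by case: z. Qed.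
Lemma ImN z : Im (- z) = - Im z. Proof. by case: z. Qed.
Lemma ReM z w : Re (z * w) = Re z * Re w - Im z * Im w.
Proof. by case: z; case: w. Qed.
Lemma ImM z w : Im (z * w) = Re z * Im w + Im z * Re w.
Proof. by case: z; case: w. Qed.
Lemma ReJ z : Re (z^*) = Re z. Proof. by case: z. Qed.
Lemma ImJ z : Im (z^*) = - Im z. Proof. by case: z. Qed.

Definition ReImE := (ReD, ImD, ReN, ImN, ReM, ImM, ReJ, ImJ).

Lemma eq_ReIm z w : Re z = Re w -> Im z = Im w -> z = w.
Proof. by case: z => a b; case: w => a' b' /= -> ->. Qed.

Lemma nsq_ge0 z : 0 <= nsq z.
Proof. by rewrite addr_ge0 ?sqr_ge0. Qed.

Lemma nsqM z w : nsq (z * w) = nsq z * nsq w.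
Proof. by rewrite /nsq !ReImE; ring. Qed.

Lemma nsqN z : nsq (- z) = nsq z.
Proof. by rewrite /nsq !ReImE !sqrrN. Qed.

Lemma nsqB z w : nsq (z - w) = nsq (w - z).
Proof. by rewrite -nsqN opprB. Qed.

Lemma nsq_real (x : R) : nsq x%:C = x ^+ 2.
Proof. by rewrite /nsq /= expr0n addr0. Qed.

Lemma nsq0 : nsq 0 = 0. Proof. by rewrite nsq_real expr0n. Qed.

Lemma nsq_expi (x : R) : nsq (expi x) = 1.
Proof. by rewrite /nsq /= cos2Dsin2. Qed.

Lemma mulc_conj z : z * z^* = (nsq z)%:C.
Proof. by apply: eq_ReIm; rewrite !ReImE /nsq /=; ring. Qed.

Lemma nsqD z w : nsq (z + w) = nsq z + nsq w + 2 * Re (w * z^*).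
Proof. by rewrite /nsq !ReImE; ring. Qed.

Lemma nsqD_le z w : nsq (z + w) <= 2 * nsq z + 2 * nsq w.
Proof.
rewrite -subr_ge0 (_ : _ - _ = nsq (z - w)) ?nsq_ge0//.
by rewrite /nsq !ReImE; ring.
Qed.

Lemma sqr_Re_le z : Re z ^+ 2 <= nsq z.
Proof. by rewrite lerDl sqr_ge0. Qed.

Lemma sqr_Im_le z : Im z ^+ 2 <= nsq z.
Proof. by rewrite lerDr sqr_ge0. Qed.

Lemma expiD (x y : R) : expi (x + y) = expi x * expi y.
Proof. by apply: eq_ReIm; rewrite !ReImE /= ?cosD ?sinD; ring. Qed.

Lemma expiN (x : R) : expi (- x) = (expi x)^*.
Proof. by rewrite /expi cosN sinN. Qed.

Lemma expi0 : expi (0 : R) = 1.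
Proof. by rewrite /expi cos0 sin0. Qed.

End SquaredModulus.

Section TrigLists.
Context (R : realType).
Implicit Types (s : seq (R[i] * int)) (a b : int).

(* A finite sequence of pairs (coefficient, frequency), where a frequency may
   occur several times, encodes a trigonometric polynomial. *)
Definition tev s (x : R) : R[i] := \sum_(m <- s) m.1 * expi (m.2%:~R * x).

Definition inband a b s := all (fun m => a <= m.2 <= b) s.

Definition tmul s1 s2 : seq (R[i] * int) :=
  [seq (m.1 * n.1, m.2 + n.2) | m <- s1, n <- s2].

Definition tconj s : seq (R[i] * int) := [seq (m.1^*, - m.2) | m <- s].

(** Partial sums of the series become filters of the list, whatever the order of its entries. *)
Definition trunc (N : int) s := [seq m <- s | m.2 <= N].

Lemma tev_nil x : tev [::] x = 0.
Proof. by rewrite /tev big_nil. Qed.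

Lemma tev_cons m s x : tev (m :: s) x = m.1 * expi (m.2%:~R * x) + tev s x.
Proof. by rewrite /tev big_cons. Qed.

Lemma tev_cat s1 s2 x : tev (s1 ++ s2) x = tev s1 x + tev s2 x.
Proof. by rewrite /tev big_cat. Qed.

Lemma tev_mul s1 s2 x : tev (tmul s1 s2) x = tev s1 x * tev s2 x.
Proof.
rewrite /tev big_allpairs_dep/= mulr_suml; apply: eq_bigr => m _.
rewrite mulr_sumr; apply: eq_bigr => n _.
by rewrite intrD mulrDl expiD mulrACA.
Qed.

Lemma tev_conj s x : tev (tconj s) x = (tev s x)^*.
Proof.
rewrite /tev big_map rmorph_sum/=; apply: eq_bigr => m _.
by rewrite rmorphM/= intrN mulNr expiN.
Qed.

Lemma tev_filter (p : pred (R[i] * int)) s x :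
  tev s x = tev [seq m <- s | p m] x + tev [seq m <- s | ~~ p m] x.
Proof.
by rewrite /tev !big_filter (bigID p).
Qed.

Lemma inband_cat a b s1 s2 :
  inband a b (s1 ++ s2) = inband a b s1 && inband a b s2.
Proof. by rewrite /inband all_cat. Qed.

Lemma inbandW a b a' b' s : a' <= a -> b <= b' -> inband a b s -> inband a' b' s.
Proof.
move=> aa' bb'; apply: sub_all => m /andP[am mb].
by rewrite (le_trans aa')//= (le_trans mb).
Qed.

Lemma inband_mul a b a' b' s1 s2 : inband a b s1 -> inband a' b' s2 ->
  inband (a + a') (b + b') (tmul s1 s2).
Proof.
move=> /allP b1 /allP b2; apply/allP => _ /allpairsP[[m n] /= [ms ns ->]] /=.
have /andP[? ?] := b1 _ ms; have /andP[? ?] := b2 _ ns.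
by rewrite !lerD.
Qed.

Lemma inband_conj a b s : inband a b s -> inband (- b) (- a) (tconj s).
Proof.
move=> /allP bs; apply/allP => _ /mapP[m ms ->] /=.
by have /andP[am mb] := bs _ ms; rewrite !lerN2 am mb.
Qed.

Lemma inband_ex s : exists D : nat, inband (- D%:Z) D%:Z s.
Proof.
elim: s => [|m s [D bD]]; first by exists 0.
exists (maxn D `|m.2|%N); rewrite /inband/=; apply/andP; split.
  rewrite -ler_norml -abszE lez_nat leq_maxr//.
by apply: inbandW bD; rewrite ?lerN2 lez_nat leq_maxl.
Qed.

Lemma trunc_id N a b s : inband a b s -> b <= N -> trunc N s = s.
Proof.
move=> bs bN; apply/all_filterP; apply: sub_all bs => m /andP[_ mb].
exact: le_trans bN.
Qed.

Lemma trunc_nil N a b s : inband a b s -> N < a -> trunc N s = [::].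
Proof.
move=> bs Na; apply/eqP; rewrite -[_ == _]negbK -has_filter -all_predC.
apply: sub_all bs => m /andP[am _] /=.
by rewrite -ltNge (lt_le_trans Na).
Qed.

Lemma trunc_cat N s1 s2 : trunc N (s1 ++ s2) = trunc N s1 ++ trunc N s2.
Proof. exact: filter_cat. Qed.

End TrigLists.

Section TrigFunctions.
Context d (T : measurableType d) (R : realType) (P : probability T R).
Variable ang : T -> R.
Hypothesis mang : measurable_fun setT ang.
Hypothesis mean_cos : forall k : int, k != 0 ->
  mean P (fun t => cos (k%:~R * ang t)) = 0.
Hypothesis mean_sin : forall k : int, k != 0 ->
  mean P (fun t => sin (k%:~R * ang t)) = 0.
Implicit Types (F G : T -> R[i]) (s : seq (R[i] * int)).

Definition band a b G := exists2 s, inband a b s & forall t, G t = tev s (ang t).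

Lemma bandM a b a' b' F G : band a b F -> band a' b' G ->
  band (a + a') (b + b') (fun t => F t * G t).
Proof.
move=> [s bs Fs] [s' bs' Gs]; exists (tmul s s'); first exact: inband_mul.
by move=> t; rewrite tev_mul Fs Gs.
Qed.

Lemma bandJ a b F : band a b F -> band (- b) (- a) (fun t => (F t)^*).
Proof.
move=> [s bs Fs]; exists (tconj s); first exact: inband_conj.
by move=> t; rewrite tev_conj Fs.
Qed.

Lemma band_expi (k : int) : band k k (fun t => expi (k%:~R * ang t)).
Proof.
exists [:: (1, k)]; first by rewrite /inband all_seq1 -[_ && _]/(_ <= _ <= _) !lexx.
by move=> t; rewrite tev_cons tev_nil addr0 mul1r.
Qed.

Lemma band_cst (c : R[i]) : band 0 0 (cst c).
Proof.
exists [:: (c, 0)]; first by rewrite /inband all_seq1 -[_ && _]/(_ <= _ <= _) !lexx.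
by move=> t; rewrite tev_cons tev_nil addr0 mul0r expi0 mulr1.
Qed.

Lemma bounded_mfun_cos_sin (k : R) : bounded_mfun (fun t => cos (k * ang t)) /\
  bounded_mfun (fun t => sin (k * ang t)).
Proof.
have mk : measurable_fun setT (fun t => k * ang t) by exact: measurable_funM.
split; split.
- by apply: measurableT_comp mk; apply: continuous_measurable_fun; exact: continuous_cos.
- by exists 1 => t; rewrite ler_norml cos_geN1 cos_le1.
- by apply: measurableT_comp mk; apply: continuous_measurable_fun; exact: continuous_sin.
- by exists 1 => t; rewrite ler_norml sin_geN1 sin_le1.
Qed.

Lemma bounded_mfun_tev s : bounded_mfun (fun t => Re (tev s (ang t))) /\
  bounded_mfun (fun t => Im (tev s (ang t))).
Proof.
elim: s => [|[c k] s [bRe bIm]].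
  by under eq_fun do rewrite tev_nil; under [X in _ /\ bounded_mfun X]eq_fun do
    rewrite tev_nil; split; exact: bounded_mfun_cst.
have [bc bs] := bounded_mfun_cos_sin k%:~R.
split.
  under eq_fun do rewrite tev_cons !ReImE/=.
  by apply: bounded_mfunD => //; apply: bounded_mfunB; exact: bounded_mfunZ.
under eq_fun do rewrite tev_cons !ReImE/=.
by apply: bounded_mfunD => //; apply: bounded_mfunD; exact: bounded_mfunZ.
Qed.

Lemma bounded_mfun_Re a b G : band a b G -> bounded_mfun (fun t => Re (G t)).
Proof.
by move=> [s _ Gs]; under eq_fun do rewrite Gs; have [] := bounded_mfun_tev s.
Qed.

Lemma bounded_mfun_Im a b G : band a b G -> bounded_mfun (fun t => Im (G t)).
Proof.
by move=> [s _ Gs]; under eq_fun do rewrite Gs; have [] := bounded_mfun_tev s.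
Qed.

Lemma bounded_mfun_nsq a b G : band a b G -> bounded_mfun (fun t => nsq (G t)).
Proof.
move=> bG; apply: bounded_mfunD; apply: bounded_mfunX.
  exact: bounded_mfun_Re bG.
exact: bounded_mfun_Im bG.
Qed.

Lemma mean_Re_band a b G : 0 < a -> band a b G -> mean P (fun t => Re (G t)) = 0.
Proof.
move=> a0 [s + Gs]; under eq_fun do rewrite Gs.
elim: s {Gs} => [_|[c k] s IHs /= /andP[/andP[/= ak _] bs]].
  by under eq_fun do rewrite tev_nil; exact: mean_cst.
have [bc bsin] := bounded_mfun_cos_sin k%:~R.
under eq_fun do rewrite tev_cons !ReImE/=.
have k0 : k != 0 by rewrite gt_eqF// (lt_le_trans a0).
rewrite meanD; last 2 first.
- by apply: bounded_mfunB; exact: bounded_mfunZ.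
- by have [] := bounded_mfun_tev s.
rewrite IHs// addr0 meanB; [|exact: bounded_mfunZ|exact: bounded_mfunZ].
by rewrite !meanZ// mean_cos// mean_sin// !mulr0 subr0.
Qed.

(** Bessel's inequality: the discarded part times the conjugate of the kept part has only
    frequencies at least 1, so its real part has mean zero and the two squared norms add up. *)
Lemma mean_nsq_trunc N s :
  mean P (fun t => nsq (tev (trunc N s) (ang t))) <=
  mean P (fun t => nsq (tev s (ang t))).
Proof.
have [D bs] := inband_ex s.
set lo := trunc N s; set hi := [seq m <- s | ~~ (m.2 <= N)].
have bF (p : pred (R[i] * int)) : inband (- D%:Z) D [seq m <- s | p m].
  by apply/allP => m; rewrite mem_filter => /andP[_]; exact: (allP bs).
have blo : band (- D%:Z) N (fun t => tev lo (ang t)).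
  exists lo => //; apply/allP => m ms; have /andP[-> _] := allP (bF _) _ ms.
  by move: ms; rewrite mem_filter => /andP[].
have bhi : band (N + 1) D (fun t => tev hi (ang t)).
  exists hi => //; apply/allP => m ms; have /andP[_ ->] := allP (bF _) _ ms.
  by move: ms; rewrite mem_filter => /andP[] /=; rewrite -ltNge andbT lezD1.
have bX := bandM bhi (bandJ blo).
have -> : (fun t => nsq (tev s (ang t))) = (fun t => nsq (tev lo (ang t)) +
    nsq (tev hi (ang t)) + 2 * Re (tev hi (ang t) * (tev lo (ang t))^*)).
  by apply/funext => t; rewrite (tev_filter (fun m => m.2 <= N)) nsqD.
have m1 := bounded_mfun_nsq blo; have m2 := bounded_mfun_nsq bhi.
have m3 := bounded_mfunZ 2 (bounded_mfun_Re bX).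
rewrite meanD//; last exact: bounded_mfunD.
rewrite meanD// meanZ; last exact: bounded_mfun_Re bX.
rewrite (mean_Re_band _ bX) ?mulr0 ?addr0; last by lia.
by rewrite lerDl; apply: mean_ge0 => t; exact: nsq_ge0.
Qed.

Definition trig G := exists s, forall t, G t = tev s (ang t).

Lemma trigP G : trig G <-> exists D : nat, band (- D%:Z) D%:Z G.
Proof.
split=> [[s Gs]|[D [s _ Gs]]]; last by exists s.
by have [D bs] := inband_ex s; exists D, s.
Qed.

Lemma band_trig a b G : band a b G -> trig G.
Proof. by move=> [s _ Gs]; exists s. Qed.

Lemma trigD F G : trig F -> trig G -> trig (fun t => F t + G t).
Proof.
by move=> [s Fs] [s' Gs]; exists (s ++ s') => t; rewrite tev_cat Fs Gs.
Qed.

Lemma trigM F G : trig F -> trig G -> trig (fun t => F t * G t).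
Proof.
by move=> [s Fs] [s' Gs]; exists (tmul s s') => t; rewrite tev_mul Fs Gs.
Qed.

Lemma trig_cst (c : R[i]) : trig (cst c).
Proof. exact: band_trig (band_cst c). Qed.

Lemma trigN F : trig F -> trig (fun t => - F t).
Proof.
move=> tF; under eq_fun do rewrite -mulN1r; apply: trigM tF; exact: trig_cst.
Qed.

Lemma trigB F G : trig F -> trig G -> trig (fun t => F t - G t).
Proof. by move=> tF tG; apply/trigD/trigN. Qed.

Lemma trigX F n : trig F -> trig (fun t => F t ^+ n).
Proof.
move=> tF; elim: n => [|n IHn]; first exact: trig_cst.
by under eq_fun do rewrite exprS; exact: trigM.
Qed.

Lemma trig_nsq F : trig F -> trig (fun t => (nsq (F t))%:C).
Proof.
move=> tF; under eq_fun do rewrite -mulc_conj; apply: trigM => //.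
by have [s Fs] := tF; exists (tconj s) => t; rewrite tev_conj Fs.
Qed.

Lemma trig_bounded_nsq F : trig F -> exists B, forall t, nsq (F t) <= B.
Proof.
move=> /trigP[D /bounded_mfun_nsq[_ [B FB]]]; exists B => t.
exact: le_trans (ler_norm _) (FB t).
Qed.

End TrigFunctions.

(** * The random walk *)

Section LogEstimates.
Context (R : realType).

(** The difference of the two sides has derivative [(u - 1) ^ 3 / u]: it decreases up to 1, where it
    vanishes, and increases afterwards. *)
Lemma ln_le_taylor3 (z : R) : 0 < z ->
  ln z <= (z - 1) - (z - 1) ^+ 2 / 2 + (z - 1) ^+ 3 / 3.
Proof.
move=> z0.
pose h (u : R) : R := (u - 1) - (u - 1) ^+ 2 / 2 + (u - 1) ^+ 3 / 3 - ln u.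
pose dh (u : R) : R := (u - 1) ^+ 3 / u.
have hd (u : R) : 0 < u -> is_derive u 1 h (dh u).
  move=> u0; have := is_derive1_ln u0 => dln.
  apply: is_derive_eq; rewrite /dh /= !scaler0 ?addr0 ?subr0 ?add0r ?scaler1.
  rewrite /GRing.scale/=.
  by field; exact: lt0r_neq0.
have hc (u : R) : 0 < u -> {for u, continuous h}.
  by move=> u0; apply/differentiable_continuous/derivable1_diffP; have [] := hd u u0.
have seg a b : 0 < a -> a <= b -> exists2 c, c \in `[a, b] & h b - h a = dh c * (b - a).
  move=> a0 ab; apply: (@MVT_segment _ h dh a b ab) => [u|].
    by rewrite in_itv/= => /andP[au _]; apply: hd; exact: lt_trans au.
  apply: continuous_in_subspaceT => u; rewrite inE/= in_itv/= => /andP[au _].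
  by apply: hc; exact: lt_le_trans au.
suff : 0 <= h z by rewrite /h subr_ge0.
have h1 : h 1 = 0 by rewrite /h ln1; lra.
have [z1|z1] := leP 1 z.
  have [c + e] := seg 1 z ltr01 z1; rewrite in_itv/= => /andP[c1 cz].
  rewrite h1 subr0 in e; rewrite e mulr_ge0 ?subr_ge0//.
  by rewrite divr_ge0 ?exprn_ge0 ?subr_ge0// (le_trans ler01).
have [c + e] := seg z 1 z0 (ltW z1); rewrite in_itv/= => /andP[c1 cz].
rewrite h1 sub0r in e; rewrite -oppr_le0 e.
have dhc : dh c <= 0.
  rewrite /dh mulr_le0_ge0//; last by rewrite invr_ge0 (le_trans (ltW z0)).
  by rewrite exprS mulr_le0_ge0 ?subr_le0// sqr_ge0.
by rewrite mulr_le0_ge0// subr_ge0 ltW.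
Qed.

(* Up to [O(a ^ 3)], the logarithm of [|1 - a e^{i th}|^2] is a combination of
   [cos th] and [cos (2 th)]. *)
Lemma ln_nsq_le (a c : R) : 0 <= a <= 1 / 4 -> `|c| <= 1 ->
  ln (1 - 2 * a * c + a ^+ 2) <=
  - (2 * a * c) - a ^+ 2 * (2 * c ^+ 2 - 1) + 11 * a ^+ 3.
Proof.
move=> /andP[a0 a1]; rewrite ler_norml => /andP[c0 c1].
have z0 : 0 < 1 - 2 * a * c + a ^+ 2 by nra.
apply: (le_trans (ln_le_taylor3 z0)).
set y := 1 - 2 * a * c + a ^+ 2 - 1.
have yE : y = - 2 * a * c + a ^+ 2 by rewrite /y; ring.
have y3 : y <= 3 * a by rewrite yE; nra.
have cub : y ^+ 3 <= 27 * a ^+ 3.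
  have [y0|/ltW y0] := leP 0 y.
    by rewrite (_ : 27 * _ = (3 * a) ^+ 3); [rewrite lerXn2r// nnegrE mulr_ge0|ring].
  apply: (@le_trans _ _ 0); last by rewrite mulr_ge0// exprn_ge0.
  by rewrite exprS mulr_le0_ge0// sqr_ge0.
(* The constant 11 is [27 / 3] from the cubic term plus 2 from the cross term [2 * a ^ 3 * c]. *)
have e : y - y ^+ 2 / 2 = - (2 * a * c) - a ^+ 2 * (2 * c ^+ 2 - 1)
    + 2 * a ^+ 3 * c - a ^+ 4 / 2 by rewrite yE; field.
have a3 : 0 <= a ^+ 3 by rewrite exprn_ge0.
have a4 : 0 <= a ^+ 4 by rewrite exprn_ge0.
have : a ^+ 3 * c <= a ^+ 3 by rewrite ler_piMr.
rewrite e; lra.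
Qed.

End LogEstimates.

(** * Blocks of consecutive terms of the series *)

Section Blocks.
Context d (T : measurableType d) (R : realType) (P : probability T R).
Variable ang : T -> R.
Hypothesis mang : measurable_fun setT ang.
Hypothesis mean_cos : forall k : int, k != 0 ->
  mean P (fun t => cos (k%:~R * ang t)) = 0.
Hypothesis mean_sin : forall k : int, k != 0 ->
  mean P (fun t => sin (k%:~R * ang t)) = 0.
Implicit Types (W F G V : T -> R[i]) (C : (T -> R[i]) -> Prop).

(** [W0] and [W1] are the remainders before and after a stretch of the series with terms [s]; the
    integer [N] runs through every place at which the stretch can be cut. [C] is a predicate on
    whole functions, so that an exceptional set may depend on [N]. *)
Definition block C W0 (N0 : nat) W1 (N1 : nat) := exists s,
  [/\ (N0 <= N1)%N, inband (N0%:Z + 1) N1%:Z s,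
      forall t, W1 t = W0 t - tev s (ang t) &
      forall N : int, C (fun t => W0 t - tev (trunc N s) (ang t))].

Lemma block_refl C W N : C W -> block C W N W N.
Proof.
move=> CW; exists [::]; split=> // [t|n]; first by rewrite tev_nil subr0.
by rewrite (_ : (fun=> _) = W)//; apply/funext => t; rewrite tev_nil subr0.
Qed.

Lemma block_mono C C' W0 N0 W1 N1 : (forall G, C G -> C' G) ->
  block C W0 N0 W1 N1 -> block C' W0 N0 W1 N1.
Proof. by move=> CC' [s [? ? ? Cs]]; exists s; split => // N; exact: CC'. Qed.

Lemma block_trans C W0 N0 W1 N1 W2 N2 :
  block C W0 N0 W1 N1 -> block C W1 N1 W2 N2 -> block C W0 N0 W2 N2.
Proof.
move=> [s [N01 bs W1E Cs]] [s' [N12 bs' W2E Cs']]; exists (s ++ s'); split.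
- exact: leq_trans N12.
- rewrite inband_cat (inbandW _ _ bs) ?(inbandW _ _ bs') ?lerD2r ?lez_nat//.
- by move=> t; rewrite W2E W1E tev_cat opprD addrA.
(* A cut up to the junction removes all of [s']; a later cut keeps all of [s], and the remainder is
   then one of the second block. *)
- move=> N; rewrite trunc_cat; have [NN1|N1N] := leP N N1%:Z.
    by rewrite (trunc_nil bs') ?cats0//; lia.
  have := Cs' N; congr C; apply/funext => t.
  by rewrite (trunc_id bs) ?tev_cat ?W1E ?opprD ?addrA// ltW.
Qed.

Lemma block_widen C W0 N0 W1 N1 N2 : (N1 <= N2)%N ->
  block C W0 N0 W1 N1 -> block C W0 N0 W1 N2.
Proof.
move=> N12 [s [N01 bs ? ?]]; exists s; split => //; first exact: leq_trans N12.
by apply: inbandW bs; rewrite ?lez_nat.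
Qed.

(** Cutting [V e^{int}] in the middle yields a polynomial of norm at most that of [V] by
    [mean_nsq_trunc], so it is enough that [C] resists every perturbation [V'] of that size in
    [L^2]. *)
Lemma block_step C W N0 V n0 : trig ang V ->
  (forall V', trig ang V' ->
    mean P (fun t => nsq (V' t)) <= mean P (fun t => nsq (V t)) ->
    C (fun t => W t - V' t)) ->
  exists n N1, (n0 <= n)%N /\
    block C W N0 (fun t => W t - V t * expi (n%:R * ang t)) N1.
Proof.
(* [D] bounds the degree of [V], so the lowest new frequency [n - D] is larger than [N0]. *)
move=> /trigP[D bV] CV; pose n := (n0 + N0 + D + 1)%N.
have [s bs Vs] := bandM bV (band_expi ang n%:Z).
exists n, (n + D)%N; split; first by rewrite /n; lia.
exists s; split => [||t|N]; first by rewrite /n; lia.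
- by apply: inbandW bs; rewrite /n; lia.
- by rewrite -Vs.
- apply: (CV (fun t => tev (trunc N s) (ang t))); first by exists (trunc N s).
  apply: le_trans (mean_nsq_trunc mang mean_cos mean_sin N s) _.
  by under eq_fun do rewrite -Vs nsqM nsq_expi mulr1.
Qed.

(** As soon as [n] exceeds the degree of [g], all frequencies of [g e^{int}] are positive: the
    orthogonality used by the walk is exact, not asymptotic. *)
Lemma mean_cos_far (g : T -> R) : trig ang (fun t => (g t)%:C) ->
  exists n0 : nat, forall n, (n0 <= n)%N ->
    mean P (fun t => g t * cos (n%:R * ang t)) = 0.
Proof.
move=> /trigP[D bg]; exists D.+1 => n Dn.
have := bandM bg (band_expi ang n%:Z).
move=> /(mean_Re_band mang mean_cos mean_sin) => <-; last by lia.
by congr mean; apply/funext => t; rewrite !ReImE/= mul0r subr0.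
Qed.

Lemma trig_real_bounded (g : T -> R) : trig ang (fun t => (g t)%:C) ->
  bounded_mfun g.
Proof. by move=> /trigP[D /(bounded_mfun_Re mang)]. Qed.

End Blocks.

Section WalkStep.
Context (R : realType).

(* One step of the walk multiplies the squared modulus [x] by
   [|1 - a e^{i th}|^2] with [a = dl * (x - m) * (M - x)], so that [x] never
   leaves [[m, M]]. *)
Lemma walk_invariant (m M dl x c a : R) : 0 < m -> m <= 1 -> 1 <= M ->
  0 <= dl -> 4 * M ^+ 2 * dl <= 1 -> m <= x <= M -> `|c| <= 1 ->
  a = dl * ((x - m) * (M - x)) ->
  m <= x * (1 - 2 * a * c + a ^+ 2) <= M /\ 0 <= a <= 1 / 4.
Proof.
move=> m0 m1 M1 dl0 dlM /andP[mx xM]; rewrite ler_norml => /andP[c0 c1] aE.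
have x0 : 0 <= x by lra.
have a0 : 0 <= a by rewrite aE !mulr_ge0// subr_ge0.
have aM : a <= dl * M * (M - x).
  rewrite aE mulrA ler_wpM2r ?subr_ge0// ler_wpM2l//.
  by apply: le_trans xM; rewrite gerBl ltW.
have am : a <= dl * M * (x - m).
  rewrite aE -mulrA ler_wpM2l//= [leLHS]mulrC ler_wpM2r ?subr_ge0//.
  by rewrite gerBl.
have dM : dl * M * M <= 1 / 4 by move: dlM; rewrite expr2; lra.
have a4 : a <= 1 / 4.
  apply: le_trans aM (le_trans _ dM).
  by rewrite ler_wpM2l ?gerBl// mulr_ge0// (le_trans ler01).
(* Since [1 - 2 * a <= 1 - 2 * a * c + a ^ 2 <= 1 + 3 * a], it suffices to compare [x * (3 * a)]
   with the distance to [M] and [x * (2 * a)] with the distance to [m]. *)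
have hi : x * (3 * a) <= M - x.
  have : M * a <= M * (dl * M * (M - x)) by rewrite ler_wpM2l// (le_trans ler01).
  have : x * a <= M * a by rewrite ler_wpM2r.
  have : dl * M * M * (M - x) <= 1 / 4 * (M - x) by rewrite ler_wpM2r ?subr_ge0.
  by nra.
have lo : x * (2 * a) <= x - m.
  have : M * a <= M * (dl * M * (x - m)) by rewrite ler_wpM2l// (le_trans ler01).
  have : x * a <= M * a by rewrite ler_wpM2r.
  have : dl * M * M * (x - m) <= 1 / 4 * (x - m) by rewrite ler_wpM2r ?subr_ge0.
  by nra.
split; last by rewrite a0.
have ac1 : a * c <= a by rewrite ler_piMr.
have ac2 : - a <= a * c by rewrite -mulrN1 ler_wpM2l.
have aa : a ^+ 2 <= a by rewrite expr2 ler_piMr//; lra.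
have a20 : 0 <= a ^+ 2 by rewrite sqr_ge0.
apply/andP; split.
  have : x * (1 - 2 * a) <= x * (1 - 2 * a * c + a ^+ 2) by rewrite ler_wpM2l//; lra.
  lra.
have : x * (1 - 2 * a * c + a ^+ 2) <= x * (1 + 3 * a) by rewrite ler_wpM2l//; lra.
lra.
Qed.

End WalkStep.

Section RealTrig.
Context d (T : measurableType d) (R : realType).
Variable ang : T -> R.
Implicit Types f g : T -> R.

Definition rtrig g := trig ang (fun t => (g t)%:C).

Lemma rtrigM f g : rtrig f -> rtrig g -> rtrig (fun t => f t * g t).
Proof. by move=> tf tg; rewrite /rtrig; under eq_fun do rewrite rmorphM/=; exact: trigM. Qed.

Lemma rtrigB f g : rtrig f -> rtrig g -> rtrig (fun t => f t - g t).
Proof. by move=> tf tg; rewrite /rtrig; under eq_fun do rewrite rmorphB/=; exact: trigB. Qed.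

Lemma rtrigD f g : rtrig f -> rtrig g -> rtrig (fun t => f t + g t).
Proof. by move=> tf tg; rewrite /rtrig; under eq_fun do rewrite rmorphD/=; exact: trigD. Qed.

Lemma rtrig_cst (r : R) : rtrig (cst r).
Proof. exact: (trig_cst ang r%:C). Qed.

Lemma rtrigX f n : rtrig f -> rtrig (fun t => f t ^+ n).
Proof. by move=> tf; rewrite /rtrig; under eq_fun do rewrite rmorphXn/=; exact: trigX. Qed.

End RealTrig.

Section Walk.
Context d (T : measurableType d) (R : realType) (P : probability T R).
Variable ang : T -> R.
Hypothesis mang : measurable_fun setT ang.
Hypothesis mean_cos : forall k : int, k != 0 ->
  mean P (fun t => cos (k%:~R * ang t)) = 0.
Hypothesis mean_sin : forall k : int, k != 0 ->
  mean P (fun t => sin (k%:~R * ang t)) = 0.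
Variables m M dl : R.
Hypotheses (m0 : 0 < m) (m1 : m <= 1) (M1 : 1 <= M) (dl0 : 0 < dl).
Hypothesis dlM : 4 * M ^+ 2 * dl <= 1.
Implicit Types (W F G V : T -> R[i]) (C : (T -> R[i]) -> Prop).

(** By [a <= dl * M ^ 2] and [m <= x], the cubic error [11 * a ^ 3] of [ln_nsq_le] is at most
    [lam * (x * a ^ 2)], that is, [lam] times the energy gained in the step. *)
Let lam : R := 11 * dl * M ^+ 2 / m.

Let lam_ge0 : 0 <= lam.
Proof.
by rewrite /lam mulr_ge0 ?invr_ge0 ?(ltW m0)// mulr_ge0 ?sqr_ge0// mulr_ge0// ltW.
Qed.

(** Polynomial in [nsq (F t)], hence the walk stays among trigonometric polynomials. *)
Definition walk_size F t : R := dl * ((nsq (F t) - m) * (M - nsq (F t))).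

(** The drift of the mean logarithm is charged to the energy: each step adds to it at most [lam]
    times what it adds to the mean of [nsq F], and the energy never exceeds [M]. *)
Definition walk_state F := [/\ trig ang F, forall t, m <= nsq (F t) <= M &
  mean P (fun t => ln (nsq (F t))) <= lam * mean P (fun t => nsq (F t))].

Lemma rtrig_walk_size F : trig ang F -> rtrig ang (walk_size F).
Proof.
move=> tF; have tn : rtrig ang (fun t => nsq (F t)) by exact: trig_nsq.
by apply/rtrigM/rtrigM/rtrigB => //; try apply: rtrigB => //; exact: rtrig_cst.
Qed.

Lemma walk_state_bounded F : walk_state F ->
  [/\ bounded_mfun (fun t => nsq (F t)), bounded_mfun (fun t => ln (nsq (F t))) &
      bounded_mfun (walk_size F)].
Proof.
move=> [tF Fm _].
have tn : rtrig ang (fun t => nsq (F t)) by exact: trig_nsq.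
have bn := trig_real_bounded mang tn; split => //.
  by apply: (bounded_mfun_ln _ m0 Fm); case: bn.
exact: (trig_real_bounded mang (rtrig_walk_size tF)).
Qed.

Lemma walk_state1 : walk_state (cst 1).
Proof.
have n1 t : nsq (cst 1 t : R[i]) = 1 :> R by rewrite (nsq_real 1) expr1n.
split; first exact: trig_cst.
- by move=> t; rewrite n1 m1.
- under eq_fun do rewrite n1 ln1; under [X in _ * mean _ X]eq_fun do rewrite n1.
  by rewrite !mean_cst mulr1 lam_ge0.
Qed.

Lemma walk_step C W F N0 : trig ang W -> walk_state F ->
  (forall V', trig ang V' -> mean P (fun t => nsq (V' t)) <=
      mean P (fun t => nsq (W t * F t * (walk_size F t)%:C)) ->
    C (fun t => W t * F t - V' t)) ->
  exists F' N1, [/\ walk_state F',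
    block ang C (fun t => W t * F t) N0 (fun t => W t * F' t) N1 &
    mean P (fun t => nsq (F' t)) = mean P (fun t => nsq (F t)) +
      mean P (fun t => nsq (F t) * walk_size F t ^+ 2)].
Proof.
move=> tW sF CV; have [tF Fm Fln] := sF.
have [bx bln ba] := walk_state_bounded sF.
pose x t := nsq (F t); pose a := walk_size F.
have tx : rtrig ang x by exact: trig_nsq.
have ta : rtrig ang a by exact: rtrig_walk_size.
(* Three orthogonality relations: against [x * a] for the energy, against [a] and [a ^ 2] for the
   first and second harmonics in the expansion of the logarithm. *)
have [n1 H1] := mean_cos_far mang mean_cos mean_sin (rtrigM tx ta).
have [n2 H2] := mean_cos_far mang mean_cos mean_sin ta.
have [n3 H3] := mean_cos_far mang mean_cos mean_sin (rtrigX 2 ta).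
have tV : trig ang (fun t => W t * F t * (a t)%:C) by apply: trigM => //; exact: trigM.
have [n [N1 [nn bl]]] := block_step mang mean_cos mean_sin N0 (n1 + n2 + n3) tV CV.
pose c t := cos (n%:R * ang t).
pose F' t := F t * (1 - (a t)%:C * expi (n%:R * ang t)).
have E1 : mean P (fun t => x t * a t * c t) = 0 by apply: H1; lia.
have E2 : mean P (fun t => a t * c t) = 0 by apply: H2; lia.
have E3 : mean P (fun t => a t ^+ 2 * (2 * c t ^+ 2 - 1)) = 0.
  rewrite -(H3 (n + n)%N) ?natrD; last by lia.
  congr mean; apply/funext => t.
  rewrite (_ : (n%:R + n%:R) * ang t = (n%:R * ang t) *+ 2); last first.
    by rewrite mulrDl mulr2n.
  by rewrite cos_mulr2n /c mulr_natl.
have tF' : trig ang F'.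
  apply: trigM => //; apply: trigB; first exact: trig_cst.
  apply: trigM => //; exact: band_trig (band_expi ang n%:Z).
have x'E t : nsq (F' t) = x t * (1 - 2 * a t * c t + a t ^+ 2).
  rewrite nsqM; congr (_ * _).
  rewrite (_ : 1 - _ + _ = 1 - 2 * a t * c t +
    a t ^+ 2 * (c t ^+ 2 + sin (n%:R * ang t) ^+ 2)); last by rewrite cos2Dsin2 mulr1.
  by rewrite /nsq !ReImE /= -/(c t); ring.
have c1 t : `|c t| <= 1 by rewrite ler_norml cos_geN1 cos_le1.
have inv t := @walk_invariant _ m M dl (x t) (c t) (a t) m0 m1 M1 (ltW dl0) dlM (Fm t) (c1 t) erefl.
have bc : bounded_mfun c by have [] := bounded_mfun_cos_sin mang n%:R.
have bac : bounded_mfun (fun t => a t * c t) by exact: bounded_mfunM.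
have ba2 : bounded_mfun (fun t => a t ^+ 2) by exact: bounded_mfunX.
have bxa2 : bounded_mfun (fun t => x t * a t ^+ 2) by exact: bounded_mfunM.
have bxac : bounded_mfun (fun t => x t * a t * c t).
  by apply: bounded_mfunM => //; exact: bounded_mfunM.
have ba2c : bounded_mfun (fun t => a t ^+ 2 * (2 * c t ^+ 2 - 1)).
  apply: bounded_mfunM => //; apply: bounded_mfunB; last exact: bounded_mfun_cst.
  exact/bounded_mfunZ/bounded_mfunX.
have energy : mean P (fun t => nsq (F' t)) = mean P x + mean P (fun t => x t * a t ^+ 2).
  have -> : (fun t => nsq (F' t)) = (fun t => x t + x t * a t ^+ 2 - 2 * (x t * a t * c t)).
    by apply/funext => t; rewrite x'E; ring.
  rewrite meanB; [|exact: bounded_mfunD|exact: bounded_mfunZ].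
  by rewrite meanZ// E1 mulr0 subr0 meanD.
have bx' : bounded_mfun (fun t => nsq (F' t)).
  by have := trig_real_bounded mang (trig_nsq tF').
have F'm t : m <= nsq (F' t) <= M by rewrite x'E; have [] := inv t.
exists F', N1; split => //; last first.
  move: bl; congr block; apply/funext => t; rewrite /F'.
  by rewrite mulrA mulrBr mulr1 !mulrA.
(* The integrand below bounds the new logarithm pointwise, and its last two terms have mean zero. *)
split => //; rewrite energy mulrDr; apply: le_trans (_ : _ <=
  mean P (fun t => ln (x t) + lam * (x t * a t ^+ 2) - 2 * (a t * c t)
    - a t ^+ 2 * (2 * c t ^+ 2 - 1))) _.
  apply: le_mean.
  - by apply: (bounded_mfun_ln _ m0 F'm); case: bx'.
  - apply: bounded_mfunB => //; apply: bounded_mfunB; last exact: bounded_mfunZ.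
    by apply: bounded_mfunD => //; exact: bounded_mfunZ.
  - move=> t; have [xm' /andP[a0 a4]] := inv t.
    have /andP[mx xM] := Fm t; have x0 : 0 < x t by exact: lt_le_trans mx.
    have z0 : 0 < 1 - 2 * a t * c t + a t ^+ 2.
      by rewrite -(pmulr_rgt0 _ x0); have /andP[+ _] := xm'; exact: lt_le_trans.
    rewrite x'E lnM ?posrE//.
    rewrite (_ : _ - _ - _ = ln (x t) + (lam * (x t * a t ^+ 2) - 2 * (a t * c t)
      - a t ^+ 2 * (2 * c t ^+ 2 - 1))); last by ring.
    rewrite lerD2l; apply: le_trans (ln_nsq_le (introT andP (conj a0 a4)) (c1 t)) _.
    have : 11 * a t ^+ 3 <= lam * (x t * a t ^+ 2).
      apply: le_trans (_ : _ <= lam * m * a t ^+ 2) _; last first.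
        by rewrite -mulrA ler_wpM2l// ler_wpM2r// sqr_ge0.
      rewrite /lam mulfVK ?gt_eqF// exprS mulrA ler_wpM2r ?sqr_ge0//.
      rewrite -mulrA ler_wpM2l// /a /walk_size ler_wpM2l ?(ltW dl0)//.
      have -> : M ^+ 2 = M * M by rewrite expr2.
      apply: ler_pM; rewrite ?subr_ge0//.
        by rewrite lerBlDr (le_trans xM)// lerDl ltW.
      by rewrite gerBl ltW.
    by lra.
rewrite meanB//; last first.
  apply: bounded_mfunB; last exact: bounded_mfunZ.
  by apply: bounded_mfunD => //; exact: bounded_mfunZ.
rewrite E3 subr0 meanB; last 2 first.
- by apply: bounded_mfunD => //; exact: bounded_mfunZ.
- exact: bounded_mfunZ.
rewrite meanZ// E2 mulr0 subr0 meanD//; last exact: bounded_mfunZ.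
by rewrite meanZ// lerD2r.
Qed.

(** A step taken while the mean of the squared size exceeds [eta] raises the energy by more than
    [m * eta], and the energy is at most [M]. So the walk has to stop, and [k] bounds the number of
    steps still possible. *)
Lemma walk_run C W eta : trig ang W -> 0 < eta ->
  (forall F, walk_state F -> forall V', trig ang V' -> mean P (fun t => nsq (V' t)) <=
      mean P (fun t => nsq (W t * F t * (walk_size F t)%:C)) ->
    C (fun t => W t * F t - V' t)) ->
  forall (k : nat) F N0, walk_state F ->
    M - k%:R * (m * eta) <= mean P (fun t => nsq (F t)) ->
  exists F' N1, [/\ walk_state F',
    block ang C (fun t => W t * F t) N0 (fun t => W t * F' t) N1 &
    mean P (fun t => walk_size F' t ^+ 2) <= eta].
Proof.
move=> tW eta0 CV.
have CW F : walk_state F -> C (fun t => W t * F t).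
  move=> sF; have : C (fun t => W t * F t - cst 0 t).
    apply: CV => //; first exact: trig_cst.
    have -> : (fun t => nsq (cst 0 t : R[i])) = cst 0 :> (T -> R).
      by apply/funext => t; exact: nsq0.
    by rewrite mean_cst; apply: mean_ge0 => t; exact: nsq_ge0.
  by congr C; apply/funext => t; rewrite /cst subr0.
have grow F N0 : walk_state F -> eta < mean P (fun t => walk_size F t ^+ 2) ->
  exists F' N1, [/\ walk_state F',
    block ang C (fun t => W t * F t) N0 (fun t => W t * F' t) N1 &
    mean P (fun t => nsq (F t)) + m * eta < mean P (fun t => nsq (F' t))].
  move=> sF large; have [F' [N1 [sF' bl en]]] := walk_step N0 tW sF (CV F sF).
  exists F', N1; split => //; rewrite en ltrD2l.
  have [bx _ ba] := walk_state_bounded sF; have ba2 := bounded_mfunX 2 ba.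
  apply: (@lt_le_trans _ _ (m * mean P (fun t => walk_size F t ^+ 2))).
    by rewrite ltr_pM2l.
  rewrite -meanZ//; apply: le_mean => [||t]; [exact: bounded_mfunZ|exact: bounded_mfunM|].
  by rewrite ler_wpM2r ?sqr_ge0//; have [_ /(_ t)/andP[]] := sF.
have le_M F : walk_state F -> mean P (fun t => nsq (F t)) <= M.
  move=> sF; have [bx _ _] := walk_state_bounded sF.
  rewrite -[leRHS](mean_cst P); apply: le_mean => //; first exact: bounded_mfun_cst.
  by move=> t; have [_ /(_ t)/andP[]] := sF.
elim=> [|k IHk] F N0 sF kF.
  have [small|large] := leP (mean P (fun t => walk_size F t ^+ 2)) eta.
    by exists F, N0; split => //; apply: block_refl; exact: CW.
  have [F' [N1 [/le_M sF' _ F'large]]] := grow F N0 sF large.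
  have : 0 < m * eta by rewrite mulr_gt0.
  by move: kF; rewrite mul0r; lra.
have [small|large] := leP (mean P (fun t => walk_size F t ^+ 2)) eta.
  by exists F, N0; split => //; apply: block_refl; exact: CW.
have [F' [N1 [sF' bl F'large]]] := grow F N0 sF large.
have [|F'' [N2 [sF'' bl' small]]] := IHk F' N1 sF'.
  by move: kF; rewrite -natr1; lra.
by exists F'', N2; split => //; exact: block_trans bl'.
Qed.

(* [ln (nsq F)] is almost a martingale and it is bounded below by [ln m]. *)
Lemma walk_tail F B : walk_state F -> lam * M <= 1 -> 1 < B ->
  whp P ((1 - ln m) / ln B) (fun t => nsq (F t) < B).
Proof.
move=> sF lamM B1; have [bx bln _] := walk_state_bounded sF.
have [_ Fm Fln] := sF.
have lnB : 0 < ln B by exact: ln_gt0.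
have lnm : ln m <= 0 by exact: ln_le0.
have c0 : 0 < ln B - ln m by lra.
(* Markov's inequality is used at the threshold [ln B - ln m]; as [ln m <= 0], the denominator may
   be relaxed to [ln B]. *)
apply: whpS (whp_markov (f := fun t => ln (nsq (F t)) - ln m) (P := P) (e := (1 - ln m) / ln B) _ _ c0 _).
- move=> t; rewrite ltrD2r; apply: contraTT; rewrite -!leNgt => BF.
  have B0 : 0 < B by exact: lt_trans B1.
  by rewrite ler_ln ?posrE// (lt_le_trans B0).
- by apply: bounded_mfunB => //; exact: bounded_mfun_cst.
- move=> t; have /andP[mF _] := Fm t.
  by rewrite subr_ge0 ler_ln ?posrE// (lt_le_trans m0).
- rewrite meanB//; last exact: bounded_mfun_cst.
  rewrite mean_cst; apply: (@le_trans _ _ (1 - ln m)).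
    rewrite lerD2r (le_trans Fln)// (le_trans _ lamM)// ler_wpM2l//.
    rewrite -[leRHS](mean_cst P); apply: le_mean => //; first exact: bounded_mfun_cst.
    by move=> t; have /andP[] := Fm t.
  rewrite mulrA ler_pdivlMr// mulrC ler_wpM2r//; lra.
Qed.

End Walk.

(** * From the random walk to one stage of the series *)

Section Stage.
Context d (T : measurableType d) (R : realType) (P : probability T R).
Variable ang : T -> R.
Hypothesis mang : measurable_fun setT ang.
Hypothesis mean_cos : forall k : int, k != 0 ->
  mean P (fun t => cos (k%:~R * ang t)) = 0.
Hypothesis mean_sin : forall k : int, k != 0 ->
  mean P (fun t => sin (k%:~R * ang t)) = 0.
Implicit Types (W F G V : T -> R[i]).

(** The numerator in [walk_tail] for the lower end [m = 1 / 16], common to all walks. *)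
Definition walk_const : R := 1 - ln (1 / 16).

(** [walk_const / ln B] bounds the probability that the walk reaches [B]; the two [tau] and the
    factor 2 pay for the incomplete term at which a partial sum is cut. *)
Definition controlled B tau W G := whp P (walk_const / ln B + tau)
  (fun t => nsq (G t) <= 2 * B * nsq (W t) + tau).

Lemma walk_const_gt0 : 0 < walk_const.
Proof.
have : ln (1 / 16) <= 0 :> R by apply: ln_le0; lra.
by rewrite /walk_const; lra.
Qed.

Lemma halving B tau W N0 : trig ang W -> 1 < B -> 0 < tau ->
  exists F N1, [/\ trig ang F,
    block ang (controlled B tau W) W N0 (fun t => W t * F t) N1 &
    whp P tau (fun t => nsq (F t) <= 1 / 8)].
Proof.
move=> tW B1 tau0.
have [BW0 nW0] := trig_bounded_nsq mang tW.
pose BW := Num.max BW0 0.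
have nW t : nsq (W t) <= BW by rewrite le_max nW0.
have BW_ge0 : 0 <= BW by rewrite le_max lexx orbT.
have K0 := walk_const_gt0; set K := walk_const in K0.
pose m : R := 1 / 16.
have m0 : 0 < m by rewrite /m; lra.
have m1 : m <= 1 by rewrite /m; lra.
(* [L] is chosen such that [K / ln L = tau / 2]; with [M = 2 * L], the event [nsq F < L] leaves
   [M - nsq F >= 1]. *)
pose L : R := expR (2 * K / tau).
have lnL : ln L = 2 * K / tau by rewrite /L expRK.
have L1 : 1 < L by rewrite /L expR_gt1 divr_gt0// mulr_gt0.
pose M : R := 2 * L.
have M1 : 1 <= M by rewrite /M; lra.
have M0 : 0 <= M by rewrite (le_trans ler01).
(* Three constraints on [dl], met together by the inverse of [1 + D1 + D2 + D3]: [D1] keeps the walk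
   between [m] and [M], [D2] gives [lam * M <= 1], and [D3] makes each single increment small in
   [L^2]. *)
pose D1 := 4 * M ^+ 2; pose D2 := 11 * M ^+ 3 / m.
pose D3 := 2 * BW * M ^+ 5 / tau ^+ 2.
have D10 : 0 <= D1 by rewrite mulr_ge0// exprn_ge0.
have D20 : 0 <= D2 by rewrite divr_ge0 ?(ltW m0)// mulr_ge0// exprn_ge0.
have D30 : 0 <= D3.
  by rewrite divr_ge0 ?sqr_ge0// mulr_ge0 ?exprn_ge0// mulr_ge0.
pose dl := (1 + D1 + D2 + D3)^-1.
have D0 : 0 < 1 + D1 + D2 + D3 by lra.
have dl0 : 0 < dl by rewrite invr_gt0.
have dl_le D : D <= 1 + D1 + D2 + D3 -> D * dl <= 1.
  by move=> DD; rewrite /dl ler_pdivrMr// mul1r.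
have dl1 : dl <= 1 by rewrite -[dl]mul1r dl_le//; lra.
have dlM : 4 * M ^+ 2 * dl <= 1 by apply: dl_le; rewrite -/D1; lra.
have lamM : 11 * dl * M ^+ 2 / m * M <= 1.
  rewrite (_ : _ * M = D2 * dl); first by apply: dl_le; lra.
  by rewrite /D2; field; rewrite gt_eqF.
have small : BW * (M * (dl * M ^+ 2) ^+ 2) <= tau / 2 * tau.
  apply: (@le_trans _ _ (BW * M ^+ 5 * dl)).
    rewrite (_ : BW * _ = BW * M ^+ 5 * dl * dl); last by ring.
    rewrite ler_piMr// mulr_ge0 ?(ltW dl0)// mulr_ge0// exprn_ge0//.
  rewrite (_ : BW * _ * _ = D3 * dl * (tau / 2 * tau)); last first.
    by rewrite /D3; field; rewrite gt_eqF.
  rewrite ler_piMl//; first by rewrite mulr_ge0 ?ltW// divr_gt0.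
  by apply: dl_le; lra.
(* Markov's inequality at the threshold [(dl * m) ^ 2] will cost [tau / 2]. Where in addition
   [M - nsq F >= 1], it gives [dl * (nsq F - m) <= a < dl * m], so [nsq F < 2 * m = 1 / 8]. *)
pose eta := dl ^+ 2 * m ^+ 2 * (tau / 2).
have eta0 : 0 < eta by rewrite !mulr_gt0 ?exprn_gt0//; lra.
have ctrl F : walk_state P ang m M dl F -> forall V', trig ang V' ->
    mean P (fun t => nsq (V' t)) <=
      mean P (fun t => nsq (W t * F t * (walk_size m M dl F t)%:C)) ->
    controlled B tau W (fun t => W t * F t - V' t).
  move=> sF V' tV' V'le; have [tF Fm _] := sF.
  have tail := walk_tail mang m0 m1 dl0 sF lamM B1.
  have bV' : bounded_mfun (fun t => nsq (V' t)).
    by have := trig_real_bounded mang (trig_nsq tV').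
  have tWFa : trig ang (fun t => W t * F t * (walk_size m M dl F t)%:C).
    by apply: trigM; [exact: trigM|exact: rtrig_walk_size].
  have bWFa : bounded_mfun (fun t => nsq (W t * F t * (walk_size m M dl F t)%:C)).
    by have := trig_real_bounded mang (trig_nsq tWFa).
  have V's : mean P (fun t => nsq (V' t)) <= tau / 2 * tau.
    apply: le_trans V'le (le_trans _ small).
    rewrite -[leRHS](mean_cst P); apply: le_mean => // [|t].
      exact: bounded_mfun_cst.
    have /andP[mF FM] := Fm t.
    rewrite !nsqM nsq_real -mulrA; apply: ler_pM => //; first exact: nsq_ge0.
      by apply: mulr_ge0; [exact: nsq_ge0|exact: sqr_ge0].
    apply: ler_pM => //; [exact: nsq_ge0|exact: sqr_ge0|].
    have a0 : 0 <= walk_size m M dl F t.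
      by rewrite mulr_ge0 ?(ltW dl0)// mulr_ge0// subr_ge0.
    have dM : 0 <= dl * M ^+ 2 by rewrite mulr_ge0 ?(ltW dl0)// sqr_ge0.
    rewrite lerXn2r// /walk_size ler_wpM2l ?(ltW dl0)// expr2.
    apply: ler_pM; rewrite ?subr_ge0//.
      by rewrite lerBlDr (le_trans FM)// lerDl ltW.
    by rewrite gerBl nsq_ge0.
  have tau2 : 0 < tau / 2 by lra.
  have := whpI tail (whp_markov bV' (fun t => nsq_ge0 _) tau2 V's).
  apply: whpS => t [xB V't].
  apply: le_trans (nsqD_le _ _) _; rewrite nsqN nsqM.
  have : nsq (W t) * nsq (F t) <= nsq (W t) * B by rewrite ler_wpM2l ?nsq_ge0// ltW.
  lra.
pose k := Num.bound (M / (m * eta)).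
have meta : 0 < m * eta by rewrite mulr_gt0.
have kM : M - k%:R * (m * eta) <= mean P (fun t => nsq (cst 1 t : R[i])).
  apply: (@le_trans _ _ 0); last by apply: mean_ge0 => t; exact: nsq_ge0.
  rewrite subr_le0 -ler_pdivrMr// ltW// /k; apply: archi_boundP.
  by rewrite divr_ge0// ltW.
have s1 := walk_state1 P ang m0 m1 M1 dl0.
have [F [N1 [sF bl Fsmall]]] := walk_run mang mean_cos mean_sin m0 m1 M1 dl0 dlM
  tW eta0 ctrl N0 s1 kM.
have [tF Fm _] := sF.
exists F, N1; split => //.
  by move: bl; congr block; apply/funext => t; rewrite mulr1.
have [bx _ ba] := walk_state_bounded mang m0 sF.
have tail := walk_tail mang m0 m1 dl0 sF lamM L1.
have c0 : 0 < dl ^+ 2 * m ^+ 2 by rewrite mulr_gt0 ?exprn_gt0.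
have := whpI tail (whp_markov (bounded_mfunX 2 ba) (fun t => sqr_ge0 _) c0 Fsmall).
apply: whp_mono => [|t [FL]].
  rewrite lnL -/walk_const -/K le_eqVlt; apply/orP; left; apply/eqP.
  by field; rewrite !gt_eqF.
rewrite -exprMn; have /andP[mF FM] := Fm t.
have a0 : 0 <= walk_size m M dl F t by rewrite !mulr_ge0 ?subr_ge0// ltW.
have dm : 0 <= dl * m by rewrite ltW// mulr_gt0.
rewrite ltr_pXn2r ?nnegrE// /walk_size ltr_pM2l// => pm.
have ML : 1 <= M - nsq (F t) by rewrite /M; lra.
have : nsq (F t) - m <= (nsq (F t) - m) * (M - nsq (F t)).
  by rewrite ler_peMr// subr_ge0.
by move: pm; rewrite /m; lra.
Qed.

(** The factor [2 * B] does not accumulate: before each new walk the remainder is already at most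
    [W] in modulus, outside a small set, so control relative to that remainder is again control
    relative to [W]. *)
Lemma iterated_halving (r : nat) B tau W N0 : trig ang W -> 1 < B -> 0 < tau ->
  exists W' N1, [/\ trig ang W', block ang (controlled B tau W) W N0 W' N1 &
    whp P tau (fun t => nsq (W' t) <= nsq (W t) / 4 ^+ r)].
Proof.
move=> tW B1; have lnB := ln_gt0 B1; have K0 := walk_const_gt0.
elim: r tau => [|r IHr] tau tau0.
  exists W, N0; split => //; last first.
    by apply: whp_all => [|t]; [exact: ltW|rewrite expr0 divr1].
  apply: block_refl; apply: whp_all => [|t].
    by rewrite addr_ge0 ?divr_ge0 ?ltW.
  by have := nsq_ge0 (W t); have := ltW tau0; nra.
have t4 : 0 < tau / 4 by lra.
have [W' [N1 [tW' bl small]]] := IHr _ t4.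
have [F [N2 [tF bl' small']]] := halving N1 tW' B1 t4.
exists (fun t => W' t * F t), N2; split; first exact: trigM.
  apply: (@block_trans _ _ _ _ _ _ _ W' N1).
    apply: block_mono bl => G; apply: whp_mono; first by lra.
    by move=> t; lra.
  apply: block_mono bl' => G /(fun h => whpI h small).
  apply: whp_mono => [|t [Gt W't]]; first by lra.
  apply: le_trans Gt _; rewrite lerD//; last by lra.
  rewrite ler_wpM2l//; first by lra.
  apply: le_trans W't _; rewrite ler_pdivrMr ?exprn_gt0// ler_peMr ?nsq_ge0//.
  by rewrite exprn_ege1//; lra.
have := whpI small small'; apply: whp_mono => [|t [W't Ft]]; first by lra.
rewrite nsqM; apply: le_trans (ler_pM (nsq_ge0 _) (nsq_ge0 _) W't Ft) _.
have r0 : (0 : R) < 4 ^+ r by rewrite exprn_gt0.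
rewrite (_ : nsq (W t) / 4 ^+ r.+1 = nsq (W t) / 4 ^+ r * (1 / 4)).
  by rewrite ler_wpM2l ?divr_ge0 ?nsq_ge0 ?(ltW r0)//; lra.
by rewrite exprS; field; rewrite gt_eqF.
Qed.

Lemma stage B tau W N0 : trig ang W -> 1 < B -> 0 < tau ->
  exists W' N1, [/\ (N0 < N1)%N, block ang (controlled B tau W) W N0 W' N1 &
    whp P tau (fun t => nsq (W' t) <= tau)].
Proof.
move=> tW B1 tau0; have [BW nW] := trig_bounded_nsq mang tW.
pose r := Num.bound (BW / tau).
have [W' [N1 [tW' bl small]]] := iterated_halving r N0 tW B1 tau0.
have N01 : (N0 <= N1)%N by case: bl => s [].
(* One spare frequency makes the bound strictly larger even if no term was added. *)
exists W', N1.+1; split => //; first exact: block_widen bl.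
apply: whpS small => t /le_trans; apply.
rewrite ler_pdivrMr ?exprn_gt0// (le_trans (nW t))// mulrC -ler_pdivrMr//.
have BW0 : 0 <= BW by apply: le_trans (nW t); exact: nsq_ge0.
apply: (@le_trans _ _ r%:R).
  by rewrite ltW//; apply: archi_boundP; rewrite divr_ge0// ltW.
by rewrite -natrX ler_nat ltnW// ltn_expl.
Qed.

End Stage.

(** * Assembling the series *)

Section Coefficients.
Context (R : realType).
Implicit Types (s : seq (R[i] * int)).

Definition coef s (k : nat) : R[i] := \sum_(m <- s | m.2 == k%:Z) m.1.

Lemma coef_cat s s' k : coef (s ++ s') k = coef s k + coef s' k.
Proof. by rewrite /coef big_cat. Qed.

Lemma coef_out a b s k : inband a b s -> k%:Z < a -> coef s k = 0.
Proof.
move=> /allP bs ka; rewrite /coef big_seq_cond big1// => m /andP[ms /eqP mk].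
by have /andP[] := bs _ ms; rewrite mk leNgt ka.
Qed.

Lemma sum_coef (D : int) s N x : inband 1 D s ->
  \sum_(1 <= k < N.+1) coef s k * expi (k%:R * x) = tev (trunc N%:Z s) x.
Proof.
elim: s => [_|[a j] s IHs /= /andP[/andP[/= j1 jD] bs]].
  rewrite tev_nil big1// => k _.
  by rewrite /coef big_nil mul0r.
have {}IHs := IHs bs.
have -> : \sum_(1 <= k < N.+1) coef ((a, j) :: s) k * expi (k%:R * x) =
    \sum_(1 <= k < N.+1 | k == `|j|%N) a * expi (k%:R * x) + tev (trunc N%:Z s) x.
  rewrite -IHs [X in _ = X + _]big_mkcond -big_split/=; apply: eq_bigr => k _.
  rewrite /coef big_cons/= (_ : (j == k%:Z) = (k == `|j|%N)); last by lia.
  by case: ifP => _; rewrite ?add0r// mulrDl.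
rewrite big_nat1_eq.
rewrite (_ : (1 <= `|j| < N.+1)%N = (j <= N%:Z)); last by lia.
case: (j <= N%:Z); last by rewrite add0r.
rewrite tev_cons/=; congr (_ * expi (_ * _) + _).
by rewrite -[j in RHS]gez0_abs//; lia.
Qed.

End Coefficients.

Section Assembly.
Context d (T : measurableType d) (R : realType) (P : probability T R).
Variable ang : T -> R.
Hypothesis mang : measurable_fun setT ang.
Hypothesis mean_cos : forall k : int, k != 0 ->
  mean P (fun t => cos (k%:~R * ang t)) = 0.
Hypothesis mean_sin : forall k : int, k != 0 ->
  mean P (fun t => sin (k%:~R * ang t)) = 0.

Lemma ex_between (f : nat -> nat) a N : (forall n, (f n < f n.+1)%N) ->
  (f a <= N)%N -> exists n, [/\ (a <= n)%N, (f n <= N)%N & (N <= f n.+1)%N].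
Proof.
move=> f_lt faN.
have f_ge n : (n <= f n)%N by elim: n => // n IHn; exact: leq_ltn_trans (f_lt n).
have ex : exists j, (a <= j)%N && (N < f j.+1)%N.
  by exists (a + N)%N; rewrite leq_addr (leq_trans _ (f_ge _))// ltnS leq_addl.
case: (ex_minnP ex) => n /andP[an Nn] nmin; exists n; split => //; last exact: ltnW.
have [an'|na] := ltnP a n; last by rewrite (_ : n = a)//; lia.
rewrite leqNgt; apply/negP => Nf; have := nmin n.-1.
by rewrite (_ : n.-1.+1 = n) ?Nf; lia.
Qed.

(** Stage [n] starts from the remainder [U n.+1 - S], where [S] is the sum so far. As [S] is close
    to [U n], this remainder has squared modulus at most [16 * (n + 2) ^ -2] outside a small set,
    which is still small after multiplication by [B = n + 2]. The target index in the conclusion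
    follows the stage that [N] falls in. *)
Lemma cvg_in_measure_targets (U : nat -> T -> R[i]) (g : nat -> T -> R) :
  (forall n, trig ang (U n)) ->
  (forall n, whp P ((n%:R + 2) ^- 2)
    (fun t => nsq (U n t - (g n t)%:C) <= (n%:R + 2) ^- 2)) ->
  (forall n t, `|g n.+1 t - g n t| <= (n%:R + 2)^-1) ->
  exists c : nat -> R[i], forall (e : R) n0, 0 < e -> exists N0, forall N, (N0 <= N)%N ->
    exists2 n, (n0 <= n)%N &
      whp P e (fun t => nsq (trig_psum c N (ang t) - (g n t)%:C) <= e).
Proof.
move=> tU Ug gg.
pose tau n : R := (n%:R + 2) ^- 2.
have n2 n : (0 : R) < n%:R + 2 by rewrite ltr_wpDl.
have tau0 n : 0 < tau n by rewrite invr_gt0 exprn_gt0.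
(* [p] and [q] hold the terms so far together with a bound on their frequencies. *)
pose next (n : nat) (p q : seq (R[i] * int) * nat) := exists u,
  [/\ q.1 = p.1 ++ u, (p.2 < q.2)%N, inband (p.2%:Z + 1) q.2%:Z u,
    forall N : int, controlled P (n%:R + 2) (tau n.+1)
      (fun t => U n.+1 t - tev p.1 (ang t))
      (fun t => U n.+1 t - tev p.1 (ang t) - tev (trunc N u) (ang t)) &
    whp P (tau n.+1) (fun t => nsq (U n.+1 t - tev q.1 (ang t)) <= tau n.+1)].
have ex_next (np : nat * (seq (R[i] * int) * nat)) : exists q, next np.1 np.2 q.
  case: np => n [s N] /=.
  have tW : trig ang (fun t => U n.+1 t - tev s (ang t)).
    by apply: trigB => //; exists s.
  have B1 : (1 : R) < n%:R + 2 by rewrite ltr_wpDl// ltrDr.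
  have [W' [N' [NN' [u [_ bu W'E cu]] small]]] :=
    stage mang mean_cos mean_sin N tW B1 (tau0 n.+1).
  exists (s ++ u, N'), u; split => //=.
  by apply: whpS small => t; rewrite W'E tev_cat opprD addrA.
have [nx nxP] := choice ex_next.
pose sq := fix sq n := if n is n'.+1 then nx (n', sq n') else ([::], 0%N).
have sqP n : next n (sq n) (sq n.+1) by exact: nxP (n, sq n).
pose s n := (sq n).1; pose f n := (sq n).2.
have f_lt n : (f n < f n.+1)%N by have [u []] := sqP n.
have f_mono : {homo f : a b / (a <= b)%N}.
  by apply: homo_leq => //; [exact: leq_trans|move=> n; exact/ltnW/f_lt].
have f_ge n : (n <= f n)%N by elim: n => // n IHn; exact: leq_ltn_trans (f_lt n).
have bs n : inband 1 (f n)%:Z (s n).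
  elim: n => // n IHn; have [u [su fn bu _ _]] := sqP n.
  rewrite /s su inband_cat (inbandW _ _ IHn) ?lez_nat//=; last exact: ltnW.
  by apply: inbandW bu; rewrite // lerDr.
have coef_s n n' k : (n <= n')%N -> (k <= f n)%N -> coef (s n') k = coef (s n) k.
  move=> + kn; elim: n' => [|n' IHn']; first by rewrite leqn0 => /eqP ->.
  rewrite leq_eqVlt => /predU1P[->//|]; rewrite ltnS => nn'.
  have [u [su _ bu _ _]] := sqP n'.
  rewrite /s su coef_cat IHn'// (coef_out bu) ?addr0//.
  by have := f_mono _ _ nn'; rewrite -/(f n'); lia.
(* All frequencies up to [f k] are settled in [s k], and [k <= f k]: later stages leave the
   coefficient of frequency [k] unchanged. *)
pose c k := coef (s k) k.
have cE n k : (k <= f n)%N -> coef (s n) k = c k.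
  move=> kn; rewrite /c; have [nk|/ltnW nk] := leqP n k.
    by rewrite (coef_s n k).
  by rewrite (coef_s k n).
have psumE n N x : (N <= f n)%N -> trig_psum c N x = tev (trunc N%:Z (s n)) x.
  move=> Nn; rewrite -(sum_coef N x (bs n)) /trig_psum.
  by apply: eq_big_nat => k /andP[_ kN]; rewrite (cE n)// (leq_trans _ Nn).
exists c => e n0 e0.
have K0 := @walk_const_gt0 R.
(* The two summands ensure [68 / b <= e] for the size and [walk_const / ln b <= e / 2] for the
   measure. In the final estimate [64 / b] is [2 * (2 * b) * (16 * tau n)], and the rest of 68
   covers the terms in [tau]. *)
pose n1 := Num.bound (68 / e + expR (2 * walk_const R / e)).
exists (f (n0 + n1).+1) => N /(ex_between f_lt)[n [nn fnN Nfn]].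
exists n.+1; first by lia.
(* Closeness of the current sum to [U n] is the outcome of the preceding stage, so [n] has to be a
   successor. *)
have [p [np n1p]] : exists p, n = p.+1 /\ (n1 <= p)%N by exists n.-1; lia.
have [_ [_ _ _ _]] := sqP p; rewrite -np -/(s n) => Us.
have [u [su _ bu cu _]] := sqP n; rewrite -/(s n) -/(f n) -/(s n.+1) in su bu cu.
pose b : R := n%:R + 2; have b0 : 0 < b by exact: n2.
have bX : 68 / e + expR (2 * walk_const R / e) <= b.
  apply: (@le_trans _ _ n1%:R).
    by rewrite ltW// archi_boundP// addr_ge0 ?expR_ge0// divr_ge0// ltW.
  by rewrite /b np -natr1 ler_wpDr// ler_wpDr// ler_nat.
have be : 68 / b <= e.
  rewrite ler_pdivrMr// mulrC -ler_pdivrMr//; apply: le_trans bX.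
  by rewrite lerDl expR_ge0.
have tau_le : tau n <= b^-1 / 2.
  rewrite /tau -/b -exprVn expr2 ler_wpM2l ?invr_ge0 ?(ltW b0)//.
  by rewrite lef_pV2 ?posrE// /b lerDr.
have tau_mono : tau n.+1 <= tau n.
  rewrite /tau lef_pV2 ?posrE ?exprn_gt0// lerXn2r// ?nnegrE ?(ltW (n2 _))//.
  by rewrite lerD2r ler_nat.
have lnb : walk_const R / ln b <= e / 2.
  have E0 : 0 < 2 * walk_const R / e by rewrite divr_gt0// mulr_gt0.
  have lnb : 2 * walk_const R / e <= ln b.
    rewrite -[leLHS]expRK ler_ln ?posrE ?expR_gt0//; apply: le_trans bX.
    by rewrite lerDr divr_ge0// ltW.
  rewrite ler_pdivrMr; last exact: lt_le_trans lnb.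
  apply: (@le_trans _ _ (e / 2 * (2 * walk_const R / e))); last first.
    by rewrite ler_wpM2l// divr_ge0// ltW.
  rewrite le_eqVlt; apply/orP; left; apply/eqP; by field; rewrite gt_eqF.
have := whpI (cu N%:Z) (whpI Us (whpI (Ug n) (Ug n.+1))).
apply: whp_mono => [|t []].
  rewrite -/b -!/(tau _); have b'0 : 0 < b^-1 by rewrite invr_gt0.
  by move: tau_mono tau_le lnb be; lra.
rewrite -!/(tau _) -/b => ctl [e1 [e2 e3]].
rewrite (psumE n.+1)// su trunc_cat (trunc_id (bs n)) ?lez_nat// tev_cat.
set S := tev (s n) (ang t) in ctl e1 *; set S' := tev (trunc _ _) _ in ctl *.
set V := U n.+1 t in ctl e3; set g' := (g n.+1 t)%:C in e3 *.
have gap : nsq (g' - (g n t)%:C) <= tau n.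
  rewrite /g' -rmorphB/= nsq_real -real_normK ?num_real// /tau -/b -exprVn.
  by rewrite lerXn2r// ?nnegrE ?invr_ge0 ?(ltW b0)//; exact: gg.
(* Four differences of squared modulus at most [tau n], and two nested uses of [nsqD_le], which cost
   a factor 4. *)
have W_le : nsq (V - S) <= 16 * tau n.
  rewrite (_ : V - S = ((V - g') + (g' - (g n t)%:C)) +
    (((g n t)%:C - U n t) + (U n t - S))); last by ring.
  have h1 := nsqD_le (V - g') (g' - (g n t)%:C).
  have h2 := nsqD_le ((g n t)%:C - U n t) (U n t - S).
  rewrite (nsqB (g n t)%:C) in h2.
  have h3 := nsqD_le ((V - g') + (g' - (g n t)%:C)) (((g n t)%:C - U n t) + (U n t - S)).
  lra.
have tb : tau n * b = b^-1 by rewrite /tau -/b; field; rewrite gt_eqF.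
rewrite (_ : S + S' - g' = (V - g') + (- (V - S - S'))); last by ring.
apply: le_trans (nsqD_le _ _) _; rewrite nsqN.
have : b * nsq (V - S) <= b * (16 * tau n) by rewrite ler_wpM2l// ltW.
move: ctl e3 tau_le tau_mono be; lra.
Qed.

End Assembly.

(** * Density of trigonometric polynomials on the circle *)

Section CircleMoments.
Context (R : realType).
Local Notation P := (@circle_measure R).

(** The identity, read as a map from the Lebesgue to the Borel sigma-algebra: continuous functions
    of the angle become measurable on the circle by composition. *)
Definition angle (t : lebesgueType R) : measurableTypeR R := t.

Lemma measurable_angle : measurable_fun setT angle.
Proof. by move=> _ Y mY; rewrite setTI; exact: sub_caratheodory. Qed.

Lemma twopi_gt0 : (0 : R) < 2 * pi.
Proof. by rewrite mulr_gt0// pi_gt0. Qed.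

(** Transport to the uniform law on [[0, 2 pi]] turns means on the circle into ordinary integrals;
    the two domains differ by the null point [2 pi]. *)
Lemma pushforward_angle A : measurable A ->
  pushforward P angle A = uniform_prob twopi_gt0 A.
Proof.
move=> mA; rewrite /pushforward circle_measureE.
have -> : completed_lebesgue_measure ((angle @^-1` A) `&` `[0, 2 * pi[%classic) =
  @lebesgue_measure R (A `&` `[0, 2 * pi[%classic) by [].
rewrite /uniform_prob integral_uniform_pdf.
under eq_integral => x.
  rewrite inE /= in_itv/= => -[_ x02].
  rewrite /uniform_pdf x02 subr0.
over.
rewrite /= integral_cst//=; last exact: measurableI.
congr (_ * _)%E; apply/eqP; rewrite eq_le; apply/andP; split.
  apply: le_measure; rewrite ?inE; [exact: measurableI|exact: measurableI|].
  by apply: setIS => x /=; rewrite !in_itv/= => /andP[-> /ltW ->].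
have m1 : measurable (A `&` `[0, 2 * pi[%classic) by exact: measurableI.
have m2 : measurable ([set 2 * pi] : set R) by exact: measurable_set1.
apply: (@le_trans _ _ (lebesgue_measure ((A `&` `[0, 2 * pi[%classic) `|` [set 2 * pi]))).
  apply: le_measure; rewrite ?inE; [exact: measurableI|exact: measurableU|].
  move=> x [Ax] /=; rewrite !in_itv/= => /andP[x0].
  by rewrite le_eqVlt => /predU1P[->|x2]; [right|left; rewrite x0 x2].
apply: le_trans (measureU2 (@lebesgue_measure R) m1 m2) _.
by rewrite [X in (_ + X)%E]lebesgue_measure_set1 adde0.
Qed.

Lemma sin_period_int (k : int) (th : R) : sin (k%:~R * (2 * pi) + th) = sin th.
Proof.
have per (n : nat) (u : R) : sin (u + n%:R * (2 * pi)) = sin u.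
  rewrite (_ : n%:R * _ = (pi *+ 2) *+ n); first by rewrite periodicn//; exact: sinD2pi.
  by rewrite mulr_natl (mulr_natl pi).
case: k => n; first by rewrite addrC per.
by rewrite -[in LHS](per n.+1 (_ + th)) NegzE intrN -pmulrn addrAC mulNr addNr add0r.
Qed.

(** Adding 1 makes the integrand nonnegative, as the change of variables requires; the phase [th]
    treats cosine and sine at once. *)
Lemma integral_1Dcos (k th : R) : k != 0 ->
  (forall u, sin (k * (2 * pi) + u) = sin u) ->
  (\int[lebesgue_measure]_(x in `[0%R, (2 * pi)%R]) (1 + cos (k * x + th))%:E =
    (2 * pi)%:E)%E.
Proof.
move=> k0 sink.
pose F (x : R) := x + k^-1 * sin (k * x + th).
have dF (x : R) : is_derive x 1 F (1 + cos (k * x + th)).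
  apply: is_derive_eq; rewrite /GRing.scale/=.
  by rewrite !mulr1 ?addr0 ?mulr0 ?add0r; field.
have cF : continuous F.
  by move=> x; apply/differentiable_continuous/derivable1_diffP; have [] := dF x.
rewrite (@continuous_FTC2 _ _ F) ?twopi_gt0//.
- rewrite -EFinB /F sink (_ : k * 0 + th = th); last by ring.
  by congr EFin; ring.
- apply: continuous_subspaceT => x.
  apply: continuousD; first exact: cst_continuous.
  apply: continuous_comp; last exact: continuous_cos.
  apply: continuousD; last exact: cst_continuous.
  by apply: continuousM; [exact: cst_continuous|exact: cvg_id].
- split.
  + by move=> x _; have [] := dF x.
  + exact/cvg_at_right_filter/cF.
  + exact/cvg_at_left_filter/cF.
- by move=> x _; rewrite derive1E; have [] := dF x.
Qed.

Lemma mean_circle_cos_shift (k : int) (th : R) : k != 0 ->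
  mean P (fun t => cos (k%:~R * angle t + th)) = 0.
Proof.
move=> k0.
have kR : (k%:~R : R) != 0 by rewrite intr_eq0.
pose h (x : R) : R := 1 + cos (k%:~R * x + th).
have ch : continuous (fun x : R => cos (k%:~R * x + th)).
  move=> x; apply: continuous_comp; last exact: continuous_cos.
  apply: continuousD; last exact: cst_continuous.
  by apply: continuousM; [exact: cst_continuous|exact: cvg_id].
have mcos : measurable_fun setT (fun x : R => cos (k%:~R * x + th)).
  exact: continuous_measurable_fun.
have mh : measurable_fun setT h by exact: measurable_funD.
have h0 x : 0 <= h x by rewrite /h -lerBlDl sub0r cos_geN1.
have bc : bounded_mfun (fun t => cos (k%:~R * angle t + th)).
  split; first exact: (measurableT_comp mcos measurable_angle).
  by exists 1 => t; rewrite ler_norml cos_geN1 cos_le1.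
have : mean P (fun t => h (angle t)) = 1.
  rewrite /mean /Rintegral -(ge0_integral_pushforward measurable_angle P measurableT (f := EFin \o h)).
  - have -> : (\int[pushforward P angle]_x (EFin \o h) x =
               \int[uniform_prob twopi_gt0]_x (EFin \o h) x)%E.
      apply: eq_measure_integral; first exact: measurable_angle.
      by move=> ? A mA _; exact: pushforward_angle.
    rewrite integral_uniform//; last exact/measurable_EFinP.
    rewrite integral_1Dcos//; last by move=> u; exact: sin_period_int.
    by rewrite subr0 -EFinM mulVf// gt_eqF// twopi_gt0.
  - exact/measurable_EFinP.
  - by move=> x _; rewrite lee_fin.
rewrite /h meanD//; last exact: bounded_mfun_cst.
by rewrite mean_cst => /eqP; rewrite addrC -subr_eq0 addrK => /eqP.
Qed.

Lemma mean_circle_cos (k : int) : k != 0 ->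
  mean P (fun t => cos (k%:~R * angle t)) = 0.
Proof.
move=> k0; rewrite -[RHS](mean_circle_cos_shift 0 k0).
by congr mean; apply/funext => t; rewrite addr0.
Qed.

Lemma mean_circle_sin (k : int) : k != 0 ->
  mean P (fun t => sin (k%:~R * angle t)) = 0.
Proof.
move=> k0; rewrite -[RHS](mean_circle_cos_shift (- (pi / 2)) k0).
by congr mean; apply/funext => t; rewrite cosBpihalf.
Qed.

End CircleMoments.

(** * Approximation in measure by trigonometric polynomials *)

Section TrigApproximable.
Context d (T : measurableType d) (R : realType) (P : probability T R).
Variable ang : T -> R.
Hypothesis mang : measurable_fun setT ang.
Implicit Types f g h : T -> R.

Definition trig_approx g := forall tau : R, 0 < tau -> exists2 U : T -> R[i],
  trig ang U & whp P tau (fun t => nsq (U t - (g t)%:C) <= tau).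

Lemma trig_approx_rtrig g : rtrig ang g -> trig_approx g.
Proof.
move=> tg tau tau0; exists (fun t => (g t)%:C) => //.
by apply: whp_all => [|t]; [|rewrite subrr nsq0]; exact: ltW.
Qed.

Lemma trig_approx_cst r : trig_approx (cst r).
Proof. exact/trig_approx_rtrig/rtrig_cst. Qed.

Lemma trig_approx_closed g : (forall tau : R, 0 < tau -> exists2 h, trig_approx h &
  whp P tau (fun t => (g t - h t) ^+ 2 <= tau)) -> trig_approx g.
Proof.
move=> gh tau tau0; have t4 : 0 < tau / 4 by lra.
have [h ah gh4] := gh _ t4; have [U tU Uh] := ah _ t4.
exists U => //; have := whpI Uh gh4; apply: whp_mono => [|t [Ut ght]]; first by lra.
rewrite (_ : U t - (g t)%:C = (U t - (h t)%:C) + (h t - g t)%:C); last first.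
  by rewrite rmorphB/= addrA subrK.
have := nsqD_le (U t - (h t)%:C) (h t - g t)%:C.
by rewrite nsq_real -sqrrN opprB; lra.
Qed.

Lemma trig_approxD f g : trig_approx f -> trig_approx g ->
  trig_approx (fun t => f t + g t).
Proof.
move=> af ag tau tau0; have t4 : 0 < tau / 4 by lra.
have [U tU Uf] := af _ t4; have [V tV Vg] := ag _ t4.
exists (fun t => U t + V t); first exact: trigD.
have := whpI Uf Vg; apply: whp_mono => [|t [Ut Vt]]; first by lra.
rewrite rmorphD/= opprD addrACA.
by have := nsqD_le (U t - (f t)%:C) (V t - (g t)%:C); lra.
Qed.

(** The order of choices matters: [U] first, then a bound on [U], then the tolerance for [V]. The
    bound [H] is there because [g] multiplies the error of [U]. *)
Lemma trig_approxM f g (H : R) : trig_approx f -> trig_approx g ->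
  (forall t, g t ^+ 2 <= H) -> trig_approx (fun t => f t * g t).
Proof.
move=> af ag gH tau tau0.
have H1 : 0 < 1 + Num.max H 0 by rewrite ltr_wpDr// le_max lexx orbT.
have t4 : 0 < tau / 4 by lra.
have [U tU Uf] := af _ (divr_gt0 t4 H1).
have [K0 UK] := trig_bounded_nsq mang tU.
have K1 : 0 < 1 + Num.max K0 0 by rewrite ltr_wpDr// le_max lexx orbT.
have [V tV Vg] := ag _ (divr_gt0 t4 K1).
exists (fun t => U t * V t); first exact: trigM.
have shrink c : 1 <= c -> tau / 4 / c <= tau / 4.
  move=> c1; rewrite ler_pdivrMr ?(lt_le_trans ltr01)// ler_peMr// ltW//.
have := whpI Uf Vg; apply: whp_mono => [|t [Ut Vt]].
  have := shrink (1 + Num.max H 0); rewrite lerDl le_max lexx orbT => /(_ isT).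
  have := shrink (1 + Num.max K0 0); rewrite lerDl le_max lexx orbT => /(_ isT).
  by lra.
rewrite (_ : U t * V t - _ =
    U t * (V t - (g t)%:C) + (g t)%:C * (U t - (f t)%:C)); last first.
  by rewrite rmorphM/=; ring.
apply: le_trans (nsqD_le _ _) _; rewrite !nsqM nsq_real.
have e1 : nsq (U t) * nsq (V t - (g t)%:C) <= tau / 4.
  apply: le_trans (_ : _ <= (1 + Num.max K0 0) * (tau / 4 / (1 + Num.max K0 0))) _.
    apply: ler_pM; rewrite ?nsq_ge0//.
    by rewrite (le_trans (UK t))// ler_wpDl// le_max lexx.
  by rewrite mulrC divfK// gt_eqF.
have e2 : g t ^+ 2 * nsq (U t - (f t)%:C) <= tau / 4.
  apply: le_trans (_ : _ <= (1 + Num.max H 0) * (tau / 4 / (1 + Num.max H 0))) _.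
    apply: ler_pM; rewrite ?nsq_ge0 ?sqr_ge0//.
    by rewrite (le_trans (gH t))// ler_wpDl// le_max lexx.
  by rewrite mulrC divfK// gt_eqF.
by lra.
Qed.

Lemma trig_approxZ r g : trig_approx g -> trig_approx (fun t => r * g t).
Proof.
move=> ag; have := trig_approxM ag (trig_approx_cst r) (fun=> lexx (r ^+ 2)).
by congr trig_approx; apply/funext => t; rewrite mulrC.
Qed.

Lemma trig_approxB f g : trig_approx f -> trig_approx g ->
  trig_approx (fun t => f t - g t).
Proof.
move=> af ag; have := trig_approxD af (trig_approxZ (-1) ag).
by congr trig_approx; apply/funext => t; rewrite mulN1r.
Qed.

Lemma sqr_indic_le1 (A : set T) t : (\1_A t : R) ^+ 2 <= 1.
Proof. by rewrite indicE; case: (_ \in _); rewrite ?expr1n// expr0n. Qed.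

Lemma trig_approx_setD (A B : set T) : trig_approx \1_A -> trig_approx \1_B ->
  trig_approx \1_(A `\` B).
Proof.
move=> aA aB; have := trig_approxB aA (trig_approxM aA aB (sqr_indic_le1 B)).
congr trig_approx; apply/funext => t; rewrite !indicE in_setD.
by case: (t \in A); case: (t \in B); rewrite /= ?mulr1 ?mulr0 ?subr0 ?subrr.
Qed.

Lemma trig_approx_setU (A B : set T) : trig_approx \1_A -> trig_approx \1_B ->
  trig_approx \1_(A `|` B).
Proof.
move=> aA aB.
have := trig_approxB (trig_approxD aA aB) (trig_approxM aA aB (sqr_indic_le1 B)).
congr trig_approx; apply/funext => t; rewrite !indicE in_setU.
by case: (t \in A); case: (t \in B);
  rewrite /= ?mulr1 ?mulr0 ?subr0 ?subrr ?addr0 ?add0r ?addrK.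
Qed.

Lemma trig_approx_set0 : trig_approx \1_(set0 : set T).
Proof.
have := trig_approx_cst 0; congr trig_approx; apply/funext => t.
by rewrite indic0.
Qed.

Lemma trig_approx_bigsetU (A : nat -> set T) n : (forall k, trig_approx \1_(A k)) ->
  trig_approx \1_(\big[setU/set0]_(k < n) A k).
Proof.
move=> aA; elim: n => [|n IHn]; first by rewrite big_ord0; exact: trig_approx_set0.
by rewrite big_ord_recr/=; exact: trig_approx_setU.
Qed.

Hypothesis approx_measurable : forall A, measurable A -> trig_approx \1_A.

(* The binary expansion of [g]: [1 / 2 <= g] is its first digit. *)
Lemma trig_approx_dyadic n g : measurable_fun setT g -> (forall t, 0 <= g t <= 1) ->
  exists2 h, trig_approx h & forall t, `|g t - h t| <= 2 ^- n.
Proof.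
elim: n g => [|n IHn] g mg g01.
  exists (cst 0); first exact: trig_approx_cst.
  by move=> t; have /andP[g0 g1] := g01 t; rewrite subr0 ger0_norm// expr0 invr1.
pose A := [set t | 1 / 2 <= g t].
have mA : measurable A.
  by rewrite -[X in measurable X]setTI; apply: measurable_fun_le.
have m1A : measurable_fun setT (\1_A : T -> R) by exact: measurable_indic.
pose g' t := 2 * g t - \1_A t.
have [||h ah gh] := IHn g'.
- by apply: measurable_funB => //; exact: measurable_funM.
- move=> t; have /andP[g0 g1] := g01 t; rewrite /g' indicE.
  case: (boolP (t \in A)) => [|]; rewrite ?notin_setE ?inE /A/= => gt; first by lra.
  by move/negP : gt; rewrite -ltNge; lra.
exists (fun t => 1 / 2 * (\1_A t + h t)).
  by apply: trig_approxZ; apply: trig_approxD => //; exact: approx_measurable.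
move=> t; rewrite (_ : _ - _ = 1 / 2 * (g' t - h t)); last by rewrite /g'; field.
rewrite normrM ger0_norm; last by lra.
have := gh t; rewrite exprS invfM; set u := 2 ^- n; lra.
Qed.

Lemma trig_approx_bounded_mfun g : bounded_mfun g -> trig_approx g.
Proof.
move=> [mg [B0 gB0]]; pose B := 1 + Num.max B0 0.
have B1 : 0 < B by rewrite ltr_wpDr// le_max lexx orbT.
have gB t : `|g t| <= B.
  by rewrite (le_trans (gB0 t))// /B ler_wpDl// le_max lexx.
pose u t := (g t + B) / (2 * B).
have u01 t : 0 <= u t <= 1.
  have := gB t; rewrite ler_norml => /andP[g0 g1].
  by rewrite /u divr_ge0 ?ler_pdivrMr//; lra.
have mu : measurable_fun setT u.
  by apply: measurable_funM => //; apply: measurable_funD.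
have au : trig_approx u.
  apply: trig_approx_closed => tau tau0.
  pose n := Num.bound tau^-1.
  have [h ah uh] := trig_approx_dyadic n mu u01.
  exists h => //; apply: whp_all => [|t]; first exact: ltW.
  have p1 : (2 : R) ^- n <= 1 by rewrite invf_le1 ?exprn_gt0// exprn_ege1//; lra.
  have pt : (2 : R) ^- n <= tau.
    rewrite invf_ple ?posrE ?exprn_gt0//; apply: (@le_trans _ _ n%:R).
      by rewrite ltW// archi_boundP// invr_ge0 ltW.
    by rewrite -natrX ler_nat ltnW// ltn_expl.
  rewrite -real_normK ?num_real//; apply: le_trans pt; apply: le_trans (uh t).
  by rewrite expr2 ler_piMr// (le_trans (uh t)).
have := trig_approxB (trig_approxZ (2 * B) au) (trig_approx_cst B).
congr trig_approx; apply/funext => t; rewrite /u mulrC divfK ?addrK//.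
by rewrite gt_eqF// mulr_gt0.
Qed.

End TrigApproximable.

(** * Polynomial approximation of a jump *)

Section PowerStep.
Context (R : realType).
Implicit Types (x u : R) (n m : nat).

Lemma bernoulli_ge u m : -1 <= u -> 1 + m%:R * u <= (1 + u) ^+ m.
Proof.
move=> u1; elim: m => [|m IHm]; first by rewrite mul0r addr0.
have u0 : 0 <= 1 + u by lra.
have := ler_wpM2l u0 IHm; rewrite -exprS; apply: le_trans.
have : 0 <= m%:R * u ^+ 2 by rewrite mulr_ge0// sqr_ge0.
rewrite -natr1; lra.
Qed.

(* The polynomials [power_step n] converge on [[0, 1]] to the indicator of
   [x < 1 / 2], except at [1 / 2]. *)
Definition power_step n x : R := (1 - x ^+ n) ^+ (2 ^ n).

Lemma power_step01 n x : 0 <= x <= 1 -> 0 <= power_step n x <= 1.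
Proof.
move=> /andP[x0 x1].
have : 0 <= x ^+ n <= 1 by rewrite exprn_ge0// exprn_ile1.
move=> /andP[xn0 xn1].
by rewrite /power_step exprn_ge0 ?exprn_ile1//; lra.
Qed.

(** Bernoulli's inequality gives [1 - 2 ^ n * x ^ n <= power_step n x]. *)
Lemma power_step_lt n x : 0 <= x <= 1 -> 1 - power_step n x <= (2 * x) ^+ n.
Proof.
move=> /andP[x0 x1].
have xn1 : x ^+ n <= 1 by rewrite exprn_ile1.
have := @bernoulli_ge (- x ^+ n) (2 ^ n)%N; rewrite lerN2 => /(_ xn1).
by rewrite /power_step exprMn natrX mulrN; lra.
Qed.

(** Multiplication by [(1 + x ^ n) ^ (2 ^ n)], which is at least [(2 * x) ^ n] by Bernoulli, leaves
    [(1 - x ^ (2 * n)) ^ (2 ^ n) <= 1]. *)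
Lemma power_step_gt n x : 1 / 2 < x <= 1 -> power_step n x <= (2 * x)^-1 ^+ n.
Proof.
move=> /andP[x2 x1]; have x0 : 0 < 2 * x by lra.
have xn0 : 0 <= x ^+ n by rewrite exprn_ge0//; lra.
have xn1 : x ^+ n <= 1 by rewrite exprn_ile1//; lra.
have q0 : 0 <= power_step n x by rewrite /power_step exprn_ge0 ?subr_ge0.
rewrite exprVn -[leRHS]div1r ler_pdivlMr ?exprn_gt0//.
apply: (@le_trans _ _ (power_step n x * (1 + x ^+ n) ^+ (2 ^ n))).
  apply: ler_wpM2l => //.
  have := @bernoulli_ge (x ^+ n) (2 ^ n)%N; rewrite exprMn natrX; lra.
rewrite /power_step -exprMn exprn_ile1//; nra.
Qed.

Lemma cvg_power_step x : 0 <= x <= 1 -> x != 1 / 2 ->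
  (power_step n x - (x < 1 / 2)%R%:R) ^+ 2 @[n --> \oo] --> (0 : R).
Proof.
move=> x01 xne; have [x0 x1] := andP x01.
have [r /andP[r0 r1] le_r] : exists2 r : R, 0 <= r < 1 & forall n : nat,
    (power_step n x - (x < 1 / 2)%R%:R) ^+ 2 <= r ^+ n.
  have q01 n : 0 <= power_step n x <= 1 by exact: power_step01.
  move: xne; rewrite neq_lt => /orP[x2|x2].
    exists (2 * x); first by apply/andP; split; lra.
    move=> n; have /andP[q0 q1] := q01 n; apply: le_trans (power_step_lt n x01).
    by rewrite x2 /=; nra.
  exists (2 * x)^-1; first by rewrite invr_ge0 invf_lt1; [apply/andP; split; lra|lra].
  move=> n; have /andP[q0 q1] := q01 n.
  apply: le_trans (power_step_gt n (introT andP (conj x2 x1))).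
  by rewrite ltNge (ltW x2) /= subr0; nra.
apply: (@squeeze_cvgr _ _ _ _ (cst 0) (fun n => r ^+ n)).
- by near=> n; rewrite sqr_ge0 le_r.
- exact: cvg_cst.
- by have := @cvg_geometric R 1 r; rewrite ger0_norm// -exprn_geometric; exact.
Unshelve. all: by end_near. Qed.

End PowerStep.

Section CircleApprox.
Context (R : realType).
Local Notation P := (@circle_measure R).
Local Notation ang := (@angle R : lebesgueType R -> R).

Lemma measurable_ang : measurable_fun setT ang.
Proof. exact: measurable_angle. Qed.

Lemma mean_cos_ang (k : int) : k != 0 -> mean P (fun t => cos (k%:~R * ang t)) = 0.
Proof. exact: mean_circle_cos. Qed.

Lemma measurable_itv_circle (i : interval R) :
  measurable ([set` i] : set (lebesgueType R)).
Proof. by apply: sub_caratheodory; exact: measurable_itv. Qed.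

(** [circle_measure] ignores what lies outside [[0, 2 pi[], and the points 0 and [a] are null; [a]
    will be the place of a jump. *)
Lemma whp_circle (a e : R) (Q : lebesgueType R -> Prop) : 0 <= e ->
  (forall t : R, 0 < t < 2 * pi -> t != a -> Q t) -> whp P e Q.
Proof.
move=> e0 GQ.
have m0 : measurable (`[0, 0] : set (lebesgueType R)) by exact: measurable_itv_circle.
have ma : measurable (`[a, a] : set (lebesgueType R)) by exact: measurable_itv_circle.
have mD := measurable_itv_circle `[0, 2 * pi[.
exists (~` `[0, 2 * pi[%classic `|` (`[0, 0]%classic `|` `[a, a]%classic)); split.
- by apply: measurableU; [exact: measurableC|exact: measurableU].
- apply: le_trans (_ : _ <= 0)%E _; last by rewrite lee_fin.
  rewrite -[X in (X <= _)%E]/(circle_measure _) circle_measureE setIUl setICl set0U.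
  have -> : 0%E = ((2 * pi)^-1%:E * 0 : \bar R)%E by rewrite mule0.
  rewrite lee_wpmul2l ?lee_fin ?inv2pi_ge0//.
  have : (completed_lebesgue_measure (`[0%R, 0%R]%classic `|` `[a, a]%classic) <= 0 :> \bar R)%E.
    apply: le_trans (measureU2 (@completed_lebesgue_measure R) m0 ma) _.
    have z (u : R) : (completed_lebesgue_measure `[u, u]%classic <= 0 :> \bar R)%E.
      have -> : completed_lebesgue_measure `[u, u]%classic = @lebesgue_measure R `[u, u]%classic by [].
      by rewrite lebesgue_measure_itv/= ltxx.
    by apply: (@le_trans _ _ (0 + 0)%E); [apply: leeD; exact: z|rewrite adde0].
  apply: le_trans; apply: le_measure; rewrite ?inE; last exact: subIsetl.
    by apply: measurableI => //; exact: measurableU.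
  exact: measurableU.
- move=> t /not_orP[/contrapT /=]; rewrite in_itv/= => /andP[t0 t2] /not_orP[].
  rewrite /= !in_itv/= => /negP te0 /negP tea; apply: GQ.
    rewrite t2 andbT lt_neqAle t0 andbT; apply: contra te0 => /eqP <-.
    by rewrite lexx.
  by apply: contra tea => /eqP ->; rewrite lexx.
Qed.

End CircleApprox.

Section RealPart.
Context d (T : measurableType d) (R : realType).
Variable ang : T -> R.

Lemma rtrig_Re (G : T -> R[i]) : trig ang G -> rtrig ang (fun t => Re (G t)).
Proof.
move=> tG; rewrite /rtrig; under eq_fun do rewrite ReJ_add.
apply: trigM; last exact: trig_cst.
by apply: trigD => //; have [s Gs] := tG; exists (tconj s) => t; rewrite tev_conj Gs.
Qed.

Lemma rtrig_cos_sin : rtrig ang (fun t => cos (ang t)) /\ rtrig ang (fun t => sin (ang t)).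
Proof.
have t1 : trig ang (fun t => expi (ang t)).
  have := band_trig (band_expi ang 1).
  by congr trig; apply/funext => t; rewrite mul1r.
split; first exact: (rtrig_Re t1).
have := rtrig_Re (trigM t1 (trig_cst ang (Complex 0 (-1)))).
by congr rtrig; apply/funext => t; move=> /=; ring.
Qed.

End RealPart.

Section CircleDensity.
Context (R : realType).
Local Notation P := (@circle_measure R).
Local Notation ang := (@angle R : lebesgueType R -> R).
Local Notation approx := (trig_approx P ang).

Lemma trig_approx_ae (a : R) (f g : lebesgueType R -> R) : approx f ->
  (forall t : R, 0 < t < 2 * pi -> t != a -> g t = f t) -> approx g.
Proof.
move=> af fg; apply: trig_approx_closed => tau tau0; exists f => //.
apply: (@whp_circle _ a); first exact: ltW.
by move=> t t0 ta; rewrite fg// subrr expr0n ltW.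
Qed.

(* For [0 < t < 2 * pi], this product is positive exactly when [t < a]. *)
Let bump (a : R) (t : lebesgueType R) : R := sin (ang t / 2) * sin ((a - ang t) / 2).

(** Each factor has half-integer frequencies, but the product is
    [(cos (t - a / 2) - cos (a / 2)) / 2]. *)
Let rtrig_bump a : rtrig ang (bump a).
Proof.
have [tc ts] := rtrig_cos_sin ang.
have -> : bump a = (fun t => (cos (ang t) * cos (a / 2) + sin (ang t) * sin (a / 2)
    - cos (a / 2)) * (1 / 2)).
  apply/funext => t; rewrite /bump.
  have -> : (a - ang t) / 2 = a / 2 - ang t / 2 by field.
  have dbl : ang t = (ang t / 2) *+ 2 by rewrite mulr2n; field.
  have -> : cos (ang t) = 1 - 2 * sin (ang t / 2) ^+ 2.
    by rewrite [in LHS]dbl cos_mulr2n cos2sin2; ring.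
  have -> : sin (ang t) = 2 * (cos (ang t / 2) * sin (ang t / 2)).
    by rewrite [in LHS]dbl sin_mulr2n -mulr_natl.
  by rewrite sinB; field.
apply: rtrigM; last exact: rtrig_cst.
apply: rtrigB; last exact: rtrig_cst.
by apply: rtrigD; apply: rtrigM => //; exact: rtrig_cst.
Qed.

Let normr_bump a t : `|bump a t| <= 1.
Proof.
by rewrite normrM -[leRHS]mulr1 ler_pM// ler_norml sin_geN1 sin_le1.
Qed.

Let rtrig_power_step n (f : lebesgueType R -> R) : rtrig ang f ->
  rtrig ang (fun t => power_step n (f t)).
Proof.
by move=> tf; apply/rtrigX/rtrigB; [exact: rtrig_cst|exact: rtrigX].
Qed.

Lemma cvg_mean_bounded (h : nat -> lebesgueType R -> R) :
  (forall n, bounded_mfun (h n)) -> (forall n t, `|h n t| <= 1) ->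
  (forall t, h n t @[n --> \oo] --> (0 : R)) ->
  mean P (h n) @[n --> \oo] --> (0 : R).
Proof.
move=> bh h1 h0.
have [] := @dominated_convergence _ (lebesgueType R) R P setT measurableT
  (fun n t => (h n t)%:E) (cst 0%E) (cst 1%E).
- by move=> n; apply/measurable_EFinP; have [] := bh n.
- exact: measurable_cst.
- by apply: aeW => t _; apply: cvg_EFin; [exact: nearW|exact: h0].
- by have := integrable_bounded_mfun P (@bounded_mfun_cst _ (lebesgueType R) R 1).
- by apply: aeW => t n _; rewrite lee_fin.
move=> _ _; rewrite integral0 => H.
exact: (fine_cvg H).
Qed.

Lemma trig_approx_le (a : R) : approx \1_([set t | t <= a] : set (lebesgueType R)).
Proof.
have [a0|a0] := leP a 0.
  apply: (@trig_approx_ae a _ _ (trig_approx_cst _ _ 0)) => t /andP[t0 _] _.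
  by rewrite indicE memNset// => /=; apply/negP; rewrite -ltNge (le_lt_trans a0).
have [a2|a2] := leP (2 * pi) a.
  apply: (@trig_approx_ae a _ _ (trig_approx_cst _ _ 1)) => t /andP[_ t2] _.
  by rewrite indicE mem_set//=; rewrite ltW// (lt_le_trans t2).
(* [x t < 1 / 2] exactly when [bump a t > 0], so on []0, 2 pi[] without [a], [power_step n (x t)]
   tends to the indicator of [t < a]. *)
pose x t := 1 / 2 - bump a t * (1 / 2).
have tx : rtrig ang x.
  by apply: rtrigB; [exact: rtrig_cst|apply: rtrigM => //; exact: rtrig_cst].
have x01 t : 0 <= x t <= 1.
  by have := normr_bump a t; rewrite ler_norml /x => /andP[b1 b2]; apply/andP; split; lra.
set A := [set t | t <= a] : set (lebesgueType R).
have mA : measurable A by have := measurable_itv_circle `]-oo, a]; rewrite set_itvE.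
(* The points 0 and [a], where [x t = 1 / 2], are left out: the factor [\1_G] makes the convergence
   hold everywhere, at no cost in measure. *)
pose G : set (lebesgueType R) := `]0, a[%classic `|` `]a, 2 * pi[%classic.
have mG : measurable G by apply: measurableU; exact: measurable_itv_circle.
have xA t : G t -> x t != 1 / 2 /\ \1_A t = (x t < 1 / 2)%R%:R :> R.
  have half u : 0 < u < 2 * pi -> 0 < sin (u / 2 : R).
    by move=> /andP[u0 u2]; apply: sin_gt0_pi; apply/andP; split; lra.
  rewrite indicE => -[|]; rewrite /= in_itv/= => /andP[t1 t2].
    have b0 : 0 < bump a t.
      by rewrite mulr_gt0//; apply: half; rewrite /angle; apply/andP; split; lra.
    have xt : x t < 1 / 2 by rewrite /x; lra.
    by rewrite xt (lt_eqF xt) mem_set//; exact: ltW.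
  have b0 : bump a t < 0.
    rewrite /bump (_ : (a - ang t) / 2 = - ((t - a) / 2)); last by rewrite /angle; ring.
    rewrite sinN mulrN oppr_lt0 mulr_gt0//; apply: half; rewrite /angle; apply/andP; split; lra.
  have xt : 1 / 2 < x t by rewrite /x; lra.
  by rewrite (gt_eqF xt) ltNge (ltW xt) memNset//=; apply/negP; rewrite -ltNge.
pose h n t := (power_step n (x t) - \1_A t) ^+ 2 * \1_G t.
have bh n : bounded_mfun (h n).
  apply: bounded_mfunM; last exact: bounded_mfun_indic.
  apply/bounded_mfunX/bounded_mfunB; last exact: bounded_mfun_indic.
  exact: (trig_real_bounded (@measurable_ang R) (rtrig_power_step n tx)).
have h_ge0 n t : 0 <= h n t by rewrite /h mulr_ge0 ?sqr_ge0.
have h1 n t : `|h n t| <= 1.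
  rewrite ger0_norm// /h -[leRHS]mulr1 ler_pM ?sqr_ge0//.
  have /andP[q0 q1] := power_step01 n (x01 t).
  by rewrite indicE; case: (t \in A) => /=; nra.
have h0 t : h n t @[n --> \oo] --> (0 : R).
  have e : \1_G t = (t \in G)%:R :> R by rewrite indicE.
  rewrite /h e; case: (boolP (t \in G)) => [/set_mem Gt|_]; last first.
    under eq_fun do rewrite mulr0; exact: cvg_cst.
  under eq_fun do rewrite mulr1; have [xt ->] := xA _ Gt.
  exact: cvg_power_step.
have mh := cvg_mean_bounded bh h1 h0.
apply: trig_approx_closed => tau tau0.
have tt0 : 0 < tau * tau by rewrite mulr_gt0.
have /cvgrPdist_lt/(_ _ tt0)[n _ /(_ n (leqnn n))] := mh.
rewrite sub0r normrN => /ltW hn.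
exists (fun t => power_step n (x t)).
  exact/trig_approx_rtrig/rtrig_power_step.
have := whp_markov (bh n) (h_ge0 n) tau0 (le_trans (ler_norm _) hn).
have aeG : whp P 0 G.
  apply: (@whp_circle _ a) => // t /andP[t0 t2]; rewrite neq_lt /G => /orP[ta|ta].
    by left; rewrite /= in_itv/= t0.
  by right; rewrite /= in_itv/= ta.
move=> /whpI/(_ aeG); apply: whp_mono => [|t [ht Gt]]; first by rewrite addr0.
have e : \1_G t = 1 :> R by rewrite indicE mem_set.
by move: ht; rewrite /h e mulr1 -sqrrN opprB => /ltW.
Qed.

End CircleDensity.

Section CircleMeasurable.
Context (R : realType).
Local Notation P := (@circle_measure R).
Local Notation ang := (@angle R : lebesgueType R -> R).
Local Notation approx := (trig_approx P ang).
Local Notation hlength := (@wlength R idfun).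

Let D : set (lebesgueType R) := `[0, 2 * pi[%classic.

Let mD : measurable D. Proof. exact: measurable_itv_circle. Qed.

Lemma circle_measure_le (A : set (lebesgueType R)) (e : R) : measurable A ->
  (completed_lebesgue_measure A <= (2 * pi * e)%:E)%E -> (P A <= e%:E)%E.
Proof.
move=> mA Ae; rewrite -[X in (X <= _)%E]/(circle_measure _) circle_measureE.
have tp := @twopi_gt0 R.
rewrite (_ : e%:E = ((2 * pi)^-1%:E * (2 * pi * e)%:E)%E); last first.
  by rewrite -EFinM mulKf// gt_eqF.
rewrite lee_wpmul2l ?lee_fin ?inv2pi_ge0//; apply: le_trans Ae.
by apply: le_measure; rewrite ?inE//; exact: measurableI.
Qed.

Lemma trig_approx_ocitv (A : set R) : ocitv A ->
  approx \1_(A : set (lebesgueType R)).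
Proof.
move=> [[a b] _ <-] /=.
have := trig_approx_setD (@measurable_ang R) (trig_approx_le b) (trig_approx_le a).
congr trig_approx; congr indic; apply/seteqP; split=> t /=.
  by move=> [tb /negP]; rewrite -ltNge in_itv/= => ->.
by rewrite in_itv/= => /andP[at_ tb]; split => //; apply/negP; rewrite -ltNge.
Qed.

(* The outer measure of [A] is an infimum over countable covers by intervals. *)
Lemma measurable_cover_approx (A : set (lebesgueType R)) (s : R) : measurable A ->
  A `<=` D -> 0 < s -> exists I : nat -> set R,
  [/\ forall k, ocitv (I k), A `<=` \bigcup_k I k,
      measurable (\bigcup_k I k : set (lebesgueType R)) &
      (completed_lebesgue_measure ((\bigcup_k I k) `\` A : set (lebesgueType R)) <= s%:E)%E].
Proof.
move=> mA AD s0.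
have Afin : completed_lebesgue_measure A \is a fin_num.
  rewrite ge0_fin_numE//.
  apply: (@le_lt_trans _ _ (completed_lebesgue_measure D)).
    by apply: le_measure; rewrite ?inE.
  have -> : completed_lebesgue_measure D = @lebesgue_measure R `[0, 2 * pi[%classic by [].
  by rewrite lebesgue_measure_itv/=; case: ifP; rewrite ?ltry.
have [_/= [I IA <-] Is] := lb_ereal_inf_adherent s0 Afin.
have [mI AI] := IA.
have mU : measurable (\bigcup_k I k : set (lebesgueType R)).
  apply: bigcupT_measurable => k; apply: sub_caratheodory.
  by apply: sub_sigma_algebra; exact: mI.
exists I; split => //.
have Ule : (completed_lebesgue_measure (\bigcup_k I k : set (lebesgueType R)) <=
    completed_lebesgue_measure A + s%:E)%E.
  apply: le_trans (ltW Is).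
  apply: (le_trans (outer_measure_sigma_subadditive hlength^*%mu I)).
  apply: lee_nneseries => // n _.
  by rewrite -((measurable_mu_extE hlength) (I n))//; exact: mI.
rewrite measureD//; last first.
  by rewrite (le_lt_trans Ule)// -(fineK Afin) -EFinD ltry.
by rewrite setIidr// leeBlDl.
Qed.

(** The part of [A] in the fundamental domain is covered by a union of intervals with little excess;
    a finite subunion misses little of that union, and finite unions of intervals are
    approximable. *)
Lemma trig_approx_measurable (A : set (lebesgueType R)) : measurable A -> approx \1_A.
Proof.
move=> mA; pose E := A `&` D.
have mE : measurable E by exact: measurableI.
apply: (@trig_approx_ae _ 0 \1_E); last first.
  move=> t /andP[t0 t2] _; rewrite !indicE in_setI (_ : t \in D) ?andbT//.
  by apply/mem_set; rewrite /D/= in_itv/= t2 ltW.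
apply: trig_approx_closed => tau tau0.
have tp := @twopi_gt0 R; have t2 : 0 < tau / 2 by lra.
have [I [oI EI mU UE]] := measurable_cover_approx mE (@subIsetr _ _ _) (mulr_gt0 tp t2).
set U := \bigcup_k I k in EI mU UE.
have mI k : measurable (I k : set (lebesgueType R)).
  by have [[a b] _ <-] := oI k; exact: measurable_itv_circle.
pose F n : set (lebesgueType R) := \big[setU/set0]_(k < n.+1) I k.
have mF n : measurable (F n) by exact: bigsetU_measurable.
have FU : \bigcup_n F n = U by rewrite bigcup_bigsetU_bigcup.
have cF : P \o F @ \oo --> P U.
  rewrite -FU; apply: nondecreasing_cvg_mu => //; first by rewrite FU.
  by move=> a b ab; exact/subsetPset/subset_bigsetU.
have [n Fn] : exists n, (P (U `\` F n) <= (tau / 2)%:E)%E.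
  have FnU n : F n `<=` U by rewrite -FU; exact: bigcup_sup.
  have PU : P U \is a fin_num by exact: fin_num_measure.
  have cF' : fine \o (P \o F) @ \oo --> fine (P U).
    by apply: fine_cvg; rewrite fineK.
  move/cvgrPdist_lt : cF' => /(_ _ t2)[n _ /(_ n (leqnn n)) /= H].
  have PF : P (F n) \is a fin_num by exact: fin_num_measure.
  have e : (P (U `\` F n) = P U - P (F n))%E.
    by rewrite measureD//= ?setIidr// -ge0_fin_numE.
  exists n; rewrite e -(fineK PU) -(fineK PF).
  by rewrite -EFinB lee_fin (le_trans (ler_norm _))// ltW.
exists \1_(F n).
  apply: trig_approx_bigsetU => [|k]; first exact: measurable_ang.
  exact: trig_approx_ocitv.
have PUE : (P (U `\` E) <= (tau / 2)%:E)%E.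
  by apply: circle_measure_le UE; exact: measurableD.
exists ((U `\` E) `|` (U `\` F n)); split.
- by apply: measurableU; exact: measurableD.
- apply: le_trans (measureU2 _ _ _) _; [exact: measurableD|exact: measurableD|].
  by rewrite [X in (_ <= X%:E)%E](_ : tau = tau / 2 + tau / 2) ?EFinD ?leeD//; field.
- move=> t /not_orP[tE tF].
  have -> : \1_E t = \1_(F n) t :> R.
    rewrite !indicE; congr (nat_of_bool _)%:R; apply/idP/idP => /set_mem h; apply/mem_set.
      by apply: contrapT => h'; apply: tF; split => //; exact: EI.
    by apply: contrapT => h'; apply: tE; split => //; rewrite -FU; exists n.
  by rewrite subrr expr0n ltW.
Qed.

Lemma circle_density (g : lebesgueType R -> R) : bounded_mfun g -> approx g.
Proof.
apply: trig_approx_bounded_mfun; first exact: measurable_ang.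
exact: trig_approx_measurable.
Qed.

End CircleMeasurable.

(** * Truncation and convergence in measure *)

Section Clamp.
Context (R : realType).
Implicit Types (L : R) (y : \bar R).

Definition clamp L y : R := fine (mine (maxe y (- L)%:E) L%:E).

Lemma clampy L : clamp L +oo%E = L.
Proof. by rewrite /clamp (max_idPl (leey _)) (min_idPr (leey _)). Qed.

Lemma clampNy L : 0 <= L -> clamp L -oo%E = - L.
Proof.
move=> L0; rewrite /clamp (max_idPr (leNye _)) (min_idPl _)//.
by rewrite lee_fin; lra.
Qed.

Lemma clampE L (r : R) : clamp L r%:E = Num.min (Num.max r (- L)) L.
Proof. by rewrite /clamp -EFin_max -EFin_min. Qed.

Lemma clamp_id L (r : R) : `|r| <= L -> clamp L r%:E = r.
Proof.
rewrite ler_norml => /andP[r1 r2]; rewrite clampE (max_idPl r1).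
exact/min_idPl.
Qed.

Lemma normr_clamp L y : 0 <= L -> `|clamp L y| <= L.
Proof.
move=> L0; case: y => [r| |]; last 2 first.
- by rewrite clampy ger0_norm.
- by rewrite clampNy// normrN ger0_norm.
by rewrite clampE /Num.max /Num.min ler_norml; case: ifP; case: ifP; lra.
Qed.

(** The bound is uniform in [y], and an equality at the infinite values; so consecutive targets are
    uniformly close even where [f] is infinite. *)
Lemma clamp_lipschitz L L' y : 0 <= L -> L <= L' -> `|clamp L' y - clamp L y| <= L' - L.
Proof.
move=> L0 LL'; have L'0 := le_trans L0 LL'.
rewrite ler_norml; case: y => [r| |]; rewrite ?clampy ?clampNy//; last 2 first.
- by apply/andP; split; lra.
- by apply/andP; split; lra.
rewrite !clampE; case: (leP (Num.max r (- L')) L'); case: (leP (Num.max r (- L)) L);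
  by case: (leP r (- L')); case: (leP r (- L)) => *; apply/andP; split; lra.
Qed.

End Clamp.

Section ConvergenceInMeasure.
Context d (T : measurableType d) (R : realType) (P : probability T R).
Implicit Types (u : nat -> T -> R) (f : T -> \bar R).

Lemma measurable_clamp L f : measurable_fun setT f -> measurable_fun setT (clamp L \o f).
Proof.
move=> mf; apply: (measurableT_comp (fine_measurable measurableT)).
by apply: measurable_mine => //; apply: measurable_maxe.
Qed.

Lemma bounded_mfun_clamp L f : 0 <= L -> measurable_fun setT f ->
  bounded_mfun (fun t => clamp L (f t)).
Proof.
move=> L0 mf; split; first exact: measurable_clamp.
by exists L => t; exact: normr_clamp.
Qed.

Lemma measurable_lt_fun (g h : T -> R) : measurable_fun setT g -> measurable_fun setT h ->
  measurable [set t | g t < h t].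
Proof.
move=> mg mh; rewrite (_ : [set t | _] = ~` [set t | h t <= g t]).
  by apply: measurableC; rewrite -[X in measurable X]setTI; exact: measurable_fun_le.
by apply/seteqP; split=> t /= => [gh|/negP]; [apply/negP|]; rewrite -ltNge.
Qed.

Lemma cvg_measure0 (A : nat -> set T) : (forall N, measurable (A N)) ->
  (forall e : R, 0 < e -> exists N0, forall N, (N0 <= N)%N -> whp P e (fun t => ~ A N t)) ->
  P (A N) @[N --> \oo] --> 0%E.
Proof.
move=> mA Ae.
have -> : (fun N => P (A N)) = (fun N => (fine (P (A N)))%:E).
  by apply/funext => N; rewrite fineK// fin_num_measure.
apply: cvg_EFin; first exact: nearW.
apply/cvgrPdist_le => e e0; have [N0 AN] := Ae e e0.
exists N0 => // N /= /AN /(measure_le_whp (mA N)) PA.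
rewrite sub0r normrN ger0_norm ?fine_ge0//.
by rewrite -lee_fin fineK// fin_num_measure.
Qed.

Lemma whp_fin_bounded f (e : R) : measurable_fun setT f -> 0 < e ->
  exists n : nat, whp P e (fun t => f t \is a fin_num -> `|fine (f t)| <= n%:R).
Proof.
move=> mf e0.
(* [fine] is 0 at infinite values, so points where [f] is infinite lie in every [F n], and the [F n]
   exhaust the space. *)
pose F (n : nat) : set T := [set t | `|fine (f t)| <= n%:R].
have mfine : measurable_fun setT (fun t => `|fine (f t)|).
  apply: measurableT_comp => //.
  exact: (measurableT_comp (fine_measurable measurableT)).
have mF n : measurable (F n).
  by rewrite -[F n]setTI; exact: measurable_fun_le.
have FT : \bigcup_n F n = setT.
  apply/seteqP; split=> // t _; exists (Num.bound `|fine (f t)|) => //=.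
  by rewrite /F/= ltW// archi_boundP.
have cF : P \o F @ \oo --> P setT.
  rewrite -FT; apply: nondecreasing_cvg_mu => //; first by rewrite FT.
  move=> a b ab; apply/subsetPset => t /= /le_trans; apply.
  by rewrite ler_nat.
have PT : P setT = 1%E by exact: probability_setT.
have cF' : fine \o (P \o F) @ \oo --> (1 : R).
  by apply: fine_cvg; rewrite -PT.
have /cvgrPdist_lt/(_ _ e0)[n _ /(_ n (leqnn n)) /= H] := cF'.
exists n, (~` F n); split; first exact: measurableC.
  have PF : P (F n) \is a fin_num by exact: fin_num_measure.
  have -> : P (~` F n) = (1 - P (F n))%E by exact: probability_setC.
  by rewrite -(fineK PF) -EFinB lee_fin (le_trans (ler_norm _))// ltW.
by move=> t /contrapT.
Qed.

(** Where [f] is finite, [clamp (L n)] is inactive outside a small set once [n] is large; where [f]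
    is infinite, its value is plus or minus [L n], which eventually exceeds any [M]. *)
Lemma cvg_in_measure_clamp u f (L : nat -> R) :
  (forall N, measurable_fun setT (u N)) -> measurable_fun setT f ->
  (forall M : R, exists n0 : nat, forall n, (n0 <= n)%N -> M <= L n) ->
  (forall n, 0 <= L n) ->
  (forall (e : R) n0, 0 < e -> exists N0, forall N, (N0 <= N)%N -> exists2 n, (n0 <= n)%N &
    whp P e (fun t => (u N t - clamp (L n) (f t)) ^+ 2 <= e)) ->
  cvg_in_measure P u f.
Proof.
move=> mu mf Linf L0 ug.
have mset1 y : measurable [set t | f t = y].
  rewrite (_ : [set t | _] = setT `&` f @^-1` [set y]); first exact: mf.
  by rewrite setTI.
split=> [eta eta0|M M0|M M0]; apply: cvg_measure0 => [N|e e0].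
- apply: (@measurableI _ _ [set t | f t \is a fin_num]
    [set t | eta < `|u N t - fine (f t)|]).
    by rewrite -[X in measurable X]setTI; exact: emeasurable_fin_num.
  apply: measurable_lt_fun => //; apply: measurableT_comp => //.
  apply: measurable_funB => //.
  exact: (measurableT_comp (fine_measurable measurableT)).
- have e2 : 0 < e / 2 by lra.
  have [k fk] := whp_fin_bounded mf e2.
  have [n0 Ln0] := Linf k%:R.
  have [|N0 H] := ug (Num.min (e / 2) (eta ^+ 2)) n0.
    by rewrite lt_min e2 exprn_gt0.
  exists N0 => N /H[n /Ln0 Ln un]; have := whpI fk un.
  apply: whp_mono => [|t [ft ut] [fint]].
    by rewrite -lerBrDl ge_min; apply/orP; left; lra.
  apply/negP; rewrite -leNgt; have {}ft := ft fint.
  rewrite -(ler_pXn2r (ltn0Sn 1)) ?nnegrE ?(ltW eta0)// real_normK ?num_real//.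
  move: ut; rewrite -{1}(fineK fint) clamp_id ?(le_trans ft)// => /le_trans; apply.
  by rewrite ge_min lexx orbT.
- by apply: (@measurableI _ _ [set t | f t = +oo%E]) => //; exact: measurable_lt_fun.
(* A squared error at most 1 leaves [u N t >= L n - 1 >= M]. *)
- have [n0 Ln0] := Linf (M + 1).
  have [|N0 H] := ug (Num.min e 1) n0; first by rewrite lt_min e0 ltr01.
  exists N0 => N /H[n /Ln0 Ln un]; move: un.
  apply: whp_mono => [|t ut [fy]]; first by rewrite ge_min lexx.
  apply/negP; rewrite -leNgt; move: ut; rewrite fy clampy//.
  by rewrite le_min => /andP[_ ut]; nra.
- by apply: (@measurableI _ _ [set t | f t = -oo%E]) => //; exact: measurable_lt_fun.
- have [n0 Ln0] := Linf (M + 1).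
  have [|N0 H] := ug (Num.min e 1) n0; first by rewrite lt_min e0 ltr01.
  exists N0 => N /H[n /Ln0 Ln un]; move: un.
  apply: whp_mono => [|t ut [fy]]; first by rewrite ge_min lexx.
  apply/negP; rewrite -leNgt; move: ut; rewrite fy clampNy//.
  by rewrite le_min => /andP[_ ut]; nra.
Qed.

End ConvergenceInMeasure.

Section LogLevels.
Context (R : realType).

(** The same [n + 2] as the bound [B] of stage [n]. *)
Definition level (n : nat) : R := ln (n%:R + 2).

Let n2_gt0 n : 0 < n%:R + 2 :> R. Proof. by rewrite ltr_wpDl. Qed.

Lemma level_ge0 n : 0 <= level n.
Proof. by rewrite ln_ge0// -lerBlDr (_ : 1 - 2 = -1) ?(le_trans (lerN10 _))//; ring. Qed.

Lemma level_mono n : level n <= level n.+1.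
Proof. by rewrite ler_ln ?posrE// lerD2r ler_nat. Qed.

Lemma level_step n : level n.+1 - level n <= (n%:R + 2)^-1.
Proof.
rewrite /level -ln_div ?posrE// (_ : _ / _ = 1 + (n%:R + 2)^-1).
  by apply: le_ln1Dx; rewrite (@lt_trans _ _ 0) ?invr_gt0// ltrN10.
by rewrite -natr1; field; rewrite gt_eqF.
Qed.

Lemma level_unbounded (M : R) : exists n0 : nat, forall n, (n0 <= n)%N -> M <= level n.
Proof.
exists (Num.bound (expR M)) => n nn.
rewrite -[M]expRK ler_ln ?posrE ?expR_gt0//.
apply: (@le_trans _ _ (Num.bound (expR M))%:R).
  by rewrite ltW// archi_boundP// expR_ge0.
by rewrite ler_wpDr// ler_nat.
Qed.

End LogLevels.

Lemma trig_psumE (R : realType) (c : nat -> R[i]) N x :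
  trig_psum c N x = tev [seq (c k, k%:Z) | k <- index_iota 1 N.+1] x.
Proof. by rewrite /tev big_map. Qed.

Theorem mainTheorem4 (R : realType) (f : R -> \bar R) :
  on_circle f ->
  measurable_fun [set: lebesgueType R] (f : lebesgueType R -> \bar R) ->
  exists c : nat -> R[i],
    cvg_in_measure (@circle_measure R)
      (fun N t => complex.Re (trig_psum c N t)) f /\
    cvg_in_measure (@circle_measure R)
      (fun N t => complex.Im (trig_psum c N t)) (fun=> 0%E).
Proof.
move=> _ mf.
pose P := @circle_measure R; pose ang := @angle R : lebesgueType R -> R.
pose g n t := clamp (level R n) (f t).
have bg n : bounded_mfun (g n : lebesgueType R -> R).
  by apply: bounded_mfun_clamp => //; exact: level_ge0.
have gE n : exists U, trig ang U /\ whp P ((n%:R + 2) ^- 2)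
    (fun t => nsq (U t - (g n t)%:C) <= (n%:R + 2) ^- 2).
  have n2 : 0 < (n%:R + 2) ^- 2 :> R by rewrite invr_gt0 exprn_gt0// ltr_wpDl.
  by have [U tU Ug] := circle_density (bg n) n2; exists U.
have [U UP] := choice gE.
have gg n t : `|g n.+1 t - g n t| <= (n%:R + 2)^-1.
  apply: le_trans (level_step R n); apply: clamp_lipschitz; first exact: level_ge0.
  exact: level_mono.
have [c cP] := cvg_in_measure_targets (@measurable_ang R) (@mean_cos_ang R)
  (@mean_circle_sin R) (fun n => (UP n).1) (fun n => (UP n).2) gg.
have mpsum N := bounded_mfun_tev (@measurable_ang R)
  [seq (c k, k%:Z) | k <- index_iota 1 N.+1].
exists c; split.
- apply: (@cvg_in_measure_clamp _ (lebesgueType R) R (@circle_measure R) _ _ (level R)).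
  + move=> N; under eq_fun do rewrite trig_psumE.
    by have [[]] := mpsum N.
  + exact: mf.
  + exact: level_unbounded.
  + exact: level_ge0.
  + move=> e n0 e0; have [N0 H] := cP e n0 e0; exists N0 => N /H[n nn ce].
    exists n => //; apply: whpS ce => t; apply: le_trans.
    by have := sqr_Re_le (trig_psum c N t - (g n t)%:C); rewrite !ReImE.
(* The targets are real and every clamp of 0 is 0, so the same criterion applies to the imaginary
   parts with limit 0. *)
- apply: (@cvg_in_measure_clamp _ (lebesgueType R) R (@circle_measure R) _ _ (level R)).
  + move=> N; under eq_fun do rewrite trig_psumE.
    by have [_ []] := mpsum N.
  + exact: measurable_cst.
  + exact: level_unbounded.
  + exact: level_ge0.
  + move=> e n0 e0; have [N0 H] := cP e n0 e0; exists N0 => N /H[n nn ce].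
    exists n => //; apply: whpS ce => t; apply: le_trans.
    have := sqr_Im_le (trig_psum c N t - (g n t)%:C); rewrite !ReImE /= oppr0.
    by rewrite clamp_id ?normr0 ?level_ge0// subr0 addr0.
Qed.
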